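(* Consider the piecewise smooth Liénard equation $$\begin{cases}\dot x=y-F_-(x),\\ \dot y=\epsilon^2(\epsilon\alpha_-+G_-(x)),\end{cases}\ x\le0,\qquad \begin{cases}\dot x=y-F_+(x),\\ \dot y=\epsilon^2(\epsilon\alpha_++G_+(x)),\end{cases}\ x\ge0,$$ where $0<\epsilon\ll1$, $\alpha_\pm$ are parameters near $0$, and the $C^\infty$-smooth functions $F_\pm,G_\pm$ satisfy $F_\pm(0)=F_\pm'(0)=G_\pm(0)=0$, $F_\pm''(0)>0$, $G_\pm'(0)<0$. Put $\beta_\pm=-\frac{2G_\pm'(0)}{F_\pm''(0)}>0$ and assume $\beta_-\ne\beta_+$. Let $[\bar y_1,\bar y_2]\subset\,]0,\infty[$. Then there exist $\epsilon_0>0$ and a small neighborhood $\mathcal U_\pm$ of $\alpha_\pm=0$ such that for each $(\epsilon,\alpha_-,\alpha_+)\in[0,\epsilon_0]\times\mathcal U_-\times\mathcal U_+$ the difference map $\Delta_{\epsilon,\alpha_-,\alpha_+}(\bar y)$ associated to the rescaled system (see context) does not have zeros in $[\bar y_1,\bar y_2]$.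
   Context: Rescaled system: the substitution $(x,y)=(\epsilon\bar x,\epsilon^2\bar y)$ followed by division of the vector field by $\epsilon$ gives, for $\epsilon>0$, $$\dot{\bar x}=\bar y-\epsilon^{-2}F_\pm(\epsilon\bar x)=\bar y-\tfrac{F_\pm''(0)}2\bar x^2+O(\epsilon\bar x^3),\qquad \dot{\bar y}=\alpha_\pm+\epsilon^{-1}G_\pm(\epsilon\bar x)=\alpha_\pm+G_\pm'(0)\bar x+O(\epsilon\bar x^2),$$ with sign $-$ on $\bar x\le0$ and sign $+$ on $\bar x\ge0$; it extends smoothly to $\epsilon=0$ by $\dot{\bar x}=\bar y-\frac{F_\pm''(0)}2\bar x^2$, $\dot{\bar y}=\alpha_\pm+G_\pm'(0)\bar x$. Difference map: for $\bar y>0$, $\Pi_{+}(\bar y)$ is the second coordinate of the first point where the forward orbit through $(0,\bar y)$ of the $+$ vector field (in $\bar x\ge0$) returns to $\{\bar x=0,\ \bar y<0\}$; $\Pi_{-}(\bar y)$ is the same for the backward orbit through $(0,\bar y)$ of the $-$ vector field (in $\bar x\le0$). Both depend on the parameters $(\epsilon,\alpha_\pm)$ and are defined on $[\bar y_1,\bar y_2]$ for parameters small enough. The difference map is $\Delta_{\epsilon,\alpha_-,\alpha_+}(\bar y)=\Pi_+(\bar y)-\Pi_-(\bar y)$. *)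

(* Defs.v *)
From Stdlib Require Import Reals Lra.
From Coquelicot Require Import Coquelicot.
Open Scope R_scope.

Definition smooth (f : R -> R) : Prop := forall (n : nat) (x : R), ex_derive_n f n x.

Definition beta (F G : R -> R) : R := - (2 * Derive G 0 / Derive_n F 2 0).

(* One branch (- or +) of the piecewise smooth Lienard equation. *)
Definition lienard_field (F G : R -> R) (eps alpha : R) (p : R * R) : R * R :=
  (snd p - F (fst p), eps ^ 2 * (eps * alpha + G (fst p))).

(* The branch [lienard_field F G eps alpha] in the coordinates
   (x, y) = (eps * xbar, eps ^ 2 * ybar), divided by eps, together with its
   smooth extension to eps = 0. *)
Definition rescaled_field (F G : R -> R) (eps alpha : R) (p : R * R) : R * R :=
  if Req_dec_T eps 0 then
    (snd p - Derive_n F 2 0 / 2 * fst p ^ 2, alpha + Derive G 0 * fst p)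
  else
    (snd p - F (eps * fst p) / eps ^ 2, alpha + G (eps * fst p) / eps).

Lemma lienard_rescaled (F G : R -> R) (eps alpha xbar ybar : R) :
  0 < eps ->
  lienard_field F G eps alpha (eps * xbar, eps ^ 2 * ybar) =
  (eps * (eps * fst (rescaled_field F G eps alpha (xbar, ybar))),
   eps ^ 2 * (eps * snd (rescaled_field F G eps alpha (xbar, ybar)))).
Proof.
intros Heps; unfold lienard_field, rescaled_field.
destruct (Req_dec_T eps 0) as [H | H]; [lra |].
simpl fst; simpl snd; f_equal; field; exact H.
Qed.

(* The derivatives at the end points a and b are two-sided; this loses no
   generality, since a solution that is one-sidedly differentiable at an end
   point can be prolonged affinely beyond it. *)
Definition solution_on (V : R * R -> R * R) (a b : R) (x y : R -> R) : Prop :=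
  forall t : R, a <= t <= b ->
    is_derive x t (fst (V (x t, y t))) /\ is_derive y t (snd (V (x t, y t))).

(* Graph of the partial map Pi_+ (forward orbit, in x >= 0). *)
Definition is_Pi_plus (F G : R -> R) (eps alpha ybar p : R) : Prop :=
  0 < ybar /\
  exists (T : R) (x y : R -> R),
    0 < T /\
    solution_on (rescaled_field F G eps alpha) 0 T x y /\
    x 0 = 0 /\ y 0 = ybar /\
    (forall t : R, 0 <= t <= T -> 0 <= x t) /\
    x T = 0 /\ y T = p /\ p < 0 /\
    (forall t : R, 0 < t < T -> ~ (x t = 0 /\ y t < 0)).

(* Graph of the partial map Pi_- (backward orbit, in x <= 0). *)
Definition is_Pi_minus (F G : R -> R) (eps alpha ybar p : R) : Prop :=
  0 < ybar /\
  exists (T : R) (x y : R -> R),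
    0 < T /\
    solution_on (rescaled_field F G eps alpha) (- T) 0 x y /\
    x 0 = 0 /\ y 0 = ybar /\
    (forall t : R, - T <= t <= 0 -> x t <= 0) /\
    x (- T) = 0 /\ y (- T) = p /\ p < 0 /\
    (forall t : R, - T < t < 0 -> ~ (x t = 0 /\ y t < 0)).

(* Graph of the partial map Delta = Pi_+ - Pi_-: it relates ybar to d exactly
   when both half-return maps are defined at ybar and their values differ by d. *)
Definition is_Delta (Fm Gm Fp Gp : R -> R) (eps alpham alphap ybar d : R) : Prop :=
  exists pp pm : R,
    is_Pi_plus Fp Gp eps alphap ybar pp /\
    is_Pi_minus Fm Gm eps alpham ybar pm /\
    d = pp - pm.

(* Main.v *)
Require Import Defs.
From Stdlib Require Import Reals Lra IndefiniteDescription.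
From Coquelicot Require Import Coquelicot.
Open Scope R_scope.

(** Write [a = F''(0) / 2] and [b = beta / 2], so that [- G'(0) = 2 a b].  On the half plane
    [x >= 0] the rescaled field is, uniformly on bounded sets, a small perturbation of
    [x' = y - a x^2, y' = - 2 a b x] when [eps] and [alpha] are small.  This limit has the first
    integral [(y + b - a x^2) exp (- y / b)], whose restriction to the axis [x = 0] is
    [axis_level b y = (y + b) exp (- y / b)].

    The perturbed orbit is followed with the first integral alone.
    - A superlevel set of the first integral at a positive level is bounded, so along a perturbed
      orbit the first integral changes at a rate proportional to the perturbation
      ([first_integral_drift]).
    - Between two levels strictly inside [(0, b)] the polar angle turns at a rate bounded away
      from zero, also after a small perturbation; since an orbit in [x > 0] can turn by less than
      [PI], it comes back to the axis before a uniform time ([half_turn_time]).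

    Together with global existence for a truncated field ([picard_lindelof]) this shows that the
    half return map exists and that each of its values [p] satisfies
    [axis_level b p ~ axis_level b ybar] ([half_return_close]).  The symmetry
    [(x, y, t) -> (- x, y, - t)] turns [Pi_-] into a map of the same kind ([Pi_minus_reflect]).

    A zero of the difference map is a common value [p < 0] of both half return maps.  In the limit
    it satisfies [axis_level b p = axis_level b ybar] for both [b = beta_- / 2] and
    [b = beta_+ / 2].  In terms of [s = 1 / b] this equation reads
    [ln (1 + s ybar) - ln (1 + s p) - s (ybar - p) = 0]; the left side vanishes at [s = 0] and has
    at most one critical point in [s > 0], hence at most one positive zero
    ([axis_level_separates]).  So distinct [beta_-] and [beta_+] have no common value, and by
    compactness they miss one by a fixed margin ([uniform_gap]), which a perturbation that is
    small enough cannot close. *)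

(** * Real analysis on an interval *)

(** Continuation along an orbit: it serves both to show that a region is never left, by refuting
    the second alternative, and to produce the time of first return. *)
Lemma first_exit (P : R -> Prop) (s T : R) :
  s <= T -> P s ->
  (forall t, s <= t <= T -> P t -> locally t P) ->
  (forall t, s <= t <= T -> P t) \/
  (exists t1, s < t1 <= T /\ (forall t, s <= t < t1 -> P t) /\ ~ P t1).
Proof.
intros HsT Ps Hopen.
set (E := fun u => s <= u <= T /\ forall t, s <= t <= u -> P t).
assert (Es : E s).
{ split; [lra |]. intros t Ht. replace t with s by lra. exact Ps. }
destruct (completeness E) as [m [Hub Hlub]].
{ exists T. intros u [Hu _]. lra. }
{ exists s. exact Es. }
assert (Hm : s <= m <= T).
{ split; [apply Hub, Es |]. apply Hlub. intros u [Hu _]. lra. }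
assert (Hbelow : forall t, s <= t < m -> P t).
{ intros t Ht. destruct (Classical_Prop.classic (P t)) as [H | H]; [exact H |].
  exfalso. enough (m <= t) by lra. apply Hlub. intros u [Hu HP].
  destruct (Rle_lt_dec u t) as [? | Hlt]; [assumption |].
  exfalso. apply H, HP. lra. }
destruct (Classical_Prop.classic (P m)) as [Pm | nPm].
- left. intros t Ht.
  destruct (Rlt_le_dec t m) as [Hlt | Hge]; [apply Hbelow; lra |].
  destruct (Req_dec m T) as [-> | HmT].
  { replace t with T by lra. exact Pm. }
  exfalso.
  destruct (Hopen m Hm Pm) as [d Hd].
  set (u := Rmin T (m + d / 2)).
  assert (Hu : m < u <= T /\ u <= m + d / 2).
  { pose proof (cond_pos d). unfold u, Rmin. destruct Rle_dec; lra. }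
  enough (u <= m) by lra. apply Hub. split; [lra |].
  intros v Hv. destruct (Rlt_le_dec v m); [apply Hbelow; lra |].
  apply Hd. change (Rabs (v - m) < d). pose proof (cond_pos d).
  rewrite Rabs_pos_eq; lra.
- right. exists m. repeat split; try tauto; try lra.
  destruct (Req_dec s m) as [e | ]; [| lra]. subst m. contradiction.
Qed.

Lemma continuous_eps (f : R -> R) (t : R) :
  continuous f t <->
  forall e, 0 < e -> locally t (fun s => Rabs (f s - f t) < e).
Proof.
split.
- intros H e He. apply (H (fun z => Rabs (z - f t) < e)).
  exists (mkposreal e He). intros z Hz. exact Hz.
- intros H. apply filterlim_locally. intros eps. apply (H eps). apply cond_pos.
Qed.

Lemma is_derive_pos_local (f : R -> R) (t l : R) :
  is_derive f t l -> 0 < l ->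
  exists r, 0 < r /\ (forall s, t < s < t + r -> f t < f s) /\
                     (forall s, t - r < s < t -> f s < f t).
Proof.
intros Hf Hl. apply is_derive_Reals in Hf. destruct (Hf l Hl) as [r Hr].
exists r. split; [apply cond_pos |].
assert (Hq : forall h, h <> 0 -> Rabs h < r -> 0 < (f (t + h) - f t) / h).
{ intros h H0 H1. specialize (Hr h H0 H1). apply Rabs_lt_between in Hr. lra. }
split; intros s Hs.
- specialize (Hq (s - t) ltac:(lra)). rewrite Rabs_pos_eq in Hq by lra.
  specialize (Hq ltac:(lra)). replace (t + (s - t)) with s in Hq by ring.
  apply (Rmult_lt_compat_r (s - t)) in Hq; [| lra].
  replace ((f s - f t) / (s - t) * (s - t)) with (f s - f t) in Hq by (field; lra). lra.
- specialize (Hq (s - t) ltac:(lra)). rewrite Rabs_left in Hq by lra.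
  specialize (Hq ltac:(lra)). replace (t + (s - t)) with s in Hq by ring.
  apply (Rmult_lt_compat_r (t - s)) in Hq; [| lra].
  replace ((f s - f t) / (s - t) * (t - s)) with (f t - f s) in Hq by (field; lra). lra.
Qed.

Lemma is_derive_continuous (f : R -> R) (t l : R) : is_derive f t l -> continuous f t.
Proof.
intros H. apply (ex_derive_continuous (V := R_NormedModule)). exists l. exact H.
Qed.

Lemma point_before (T w : R) : 0 < T -> 0 < w -> exists t, 0 < t < T /\ T - w < t.
Proof.
intros HT Hw. exists (Rmax (T / 2) (T - w / 2)). unfold Rmax. destruct Rle_dec; lra.
Qed.

Lemma limit_nonneg (f : R -> R) (T : R) :
  0 < T -> (forall t, 0 < t < T -> 0 < f t) -> continuous f T -> 0 <= f T.
Proof.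
intros HT Hpos cf. apply Rnot_lt_le. intros Hneg.
destruct (cf (fun z => z < 0) (open_lt 0 _ Hneg)) as [w Hw].
destruct (point_before T w HT (cond_pos w)) as [t [Ht Htw]].
pose proof (Hpos t Ht).
assert (f t < 0); [| lra].
apply Hw. change (Rabs (t - T) < w). apply Rabs_lt_between. lra.
Qed.

Lemma derive_nonpos_at_zero (f : R -> R) (T l : R) :
  0 < T -> (forall t, 0 < t < T -> 0 <= f t) -> f T = 0 -> is_derive f T l -> l <= 0.
Proof.
intros HT Hnn fT Df. apply Rnot_lt_le. intros Hl.
destruct (is_derive_pos_local f T l Df Hl) as [w [Hw [_ Hleft]]].
destruct (point_before T w HT Hw) as [t [Ht Htw]].
pose proof (Hleft t ltac:(lra)). pose proof (Hnn t Ht). lra.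
Qed.

(** * Existence of solutions *)

(** The intervals centred at [u n] with radius [2 c / 2 ^ n] are nested, and the limit is their
    common point. *)
Lemma geometric_limit (u : nat -> R) (c : R) :
  (forall n, Rabs (u (S n) - u n) <= c * (1 / 2) ^ n) ->
  {l : R | forall n, Rabs (l - u n) <= 2 * c * (1 / 2) ^ n}.
Proof.
intros Hu.
assert (step : forall n, u n - 2 * c * (1/2)^n <= u (S n) - 2 * c * (1/2)^(S n)
   /\ u (S n) + 2 * c * (1/2)^(S n) <= u n + 2 * c * (1/2)^n).
{ intros n. specialize (Hu n). apply Rabs_le_between in Hu. simpl. lra. }
assert (Hc : 0 <= c).
{ pose proof (Hu O) as H. pose proof (Rabs_pos (u 1%nat - u O)). simpl in H. lra. }
assert (cross : forall m n, u m - 2 * c * (1/2)^m <= u n + 2 * c * (1/2)^n).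
{ assert (inc : forall k m, u m - 2 * c * (1/2)^m <= u (k + m)%nat - 2 * c * (1/2)^(k + m)).
  { induction k; intros m; [apply Rle_refl |].
    eapply Rle_trans; [apply IHk | apply (step (k + m)%nat)]. }
  assert (dec : forall k m, u (k + m)%nat + 2 * c * (1/2)^(k + m) <= u m + 2 * c * (1/2)^m).
  { induction k; intros m; [apply Rle_refl |].
    eapply Rle_trans; [apply (step (k + m)%nat) | apply IHk]. }
  assert (pos : forall n, 0 <= 2 * c * (1/2)^n).
  { intros n. apply Rmult_le_pos; [lra |]. apply pow_le. lra. }
  intros m n.
  pose proof (inc n m). pose proof (dec m n). pose proof (pos (n + m)%nat).
  rewrite (PeanoNat.Nat.add_comm m n) in *. lra. }
destruct (completeness (fun v => exists n, v = u n - 2 * c * (1/2)^n)) as [l [Hub Hlub]].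
{ exists (u O + 2 * c * (1/2)^0). intros v [n ->]. apply cross. }
{ eexists. exists O. reflexivity. }
exists l. intros n. apply Rabs_le_between.
assert (u n - 2 * c * (1/2)^n <= l) by (apply Hub; exists n; reflexivity).
assert (l <= u n + 2 * c * (1/2)^n) by (apply Hlub; intros v [m ->]; apply cross).
lra.
Qed.

Lemma le_of_geometric (r c : R) : (forall n, r <= c * (1 / 2) ^ n) -> r <= 0.
Proof.
intros H.
assert (L : is_lim_seq (fun n => c * (1/2)^n) (c * 0)).
{ apply (is_lim_seq_scal_l _ c 0). apply is_lim_seq_geom. rewrite Rabs_pos_eq; lra. }
rewrite Rmult_0_r in L.
apply (is_lim_seq_le (fun _ => r) _ r 0 H (is_lim_seq_const r) L).
Qed.

(** In the norm [sup |f t| exp (- k t)], integration from [0] is Lipschitz with constant [1 / k];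
    with a large [k] Picard iteration contracts on all of [0, +oo) at once. *)
Lemma RInt_exp_close (f g : R -> R) (C k t : R) :
  0 < k -> 0 <= t ->
  (forall s, continuous f s) -> (forall s, continuous g s) ->
  (forall s, 0 <= s <= t -> Rabs (f s - g s) <= C * exp (k * s)) ->
  Rabs (RInt f 0 t - RInt g 0 t) <= C / k * exp (k * t).
Proof.
intros Hk Ht cf cg Hfg.
assert (HC : 0 <= C).
{ pose proof (Hfg 0 ltac:(lra)) as H0. rewrite Rmult_0_r, exp_0 in H0.
  pose proof (Rabs_pos (f 0 - g 0)). lra. }
assert (xf : ex_RInt f 0 t) by (apply (ex_RInt_continuous (V := R_CompleteNormedModule)); auto).
assert (xg : ex_RInt g 0 t) by (apply (ex_RInt_continuous (V := R_CompleteNormedModule)); auto).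
assert (Hle : Rabs (RInt f 0 t - RInt g 0 t)
              <= C / k * exp (k * t) - C / k * exp (k * 0)).
{ apply (norm_RInt_le (V := R_NormedModule) (fun s => f s - g s)
    (fun s => C * exp (k * s)) 0 t); [exact Ht | exact Hfg | |].
  - apply (is_RInt_minus (V := R_NormedModule)); apply (RInt_correct (V := R_CompleteNormedModule)); assumption.
  - apply (is_RInt_derive (V := R_CompleteNormedModule)
      (fun s => C / k * exp (k * s)) (fun s => C * exp (k * s))).
    + intros s _. auto_derive; [exact I | field; lra].
    + intros s _. apply (ex_derive_continuous (V := R_NormedModule)). auto_derive. exact I. }
assert (0 <= C / k) by (apply Rdiv_le_0_compat; lra).
rewrite Rmult_0_r, exp_0 in Hle. lra.
Qed.

Lemma continuous_clip (f : R -> R) (t : R) :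
  (forall s, continuous f s) -> continuous (fun s => f (Rmax 0 s)) t.
Proof.
intros Hf. apply (continuous_comp (fun s => Rmax 0 s) f); [| apply Hf].
apply continuous_eps. intros e He. exists (mkposreal e He). intros s Hs.
change (Rabs (s - t) < e) in Hs. apply Rabs_lt_between in Hs. apply Rabs_lt_between.
unfold Rmax. destruct (Rle_dec 0 s), (Rle_dec 0 t); lra.
Qed.

Lemma continuous_lipschitz2 (P : R -> R -> R) (L : R) (x y : R -> R) (t : R) :
  0 < L ->
  (forall u v u' v', Rabs (P u v - P u' v') <= L * (Rabs (u - u') + Rabs (v - v'))) ->
  continuous x t -> continuous y t -> continuous (fun s => P (x s) (y s)) t.
Proof.
intros HL HP cx cy. apply continuous_eps. intros e He.
assert (He' : 0 < e / (2 * L)) by (apply Rdiv_lt_0_compat; lra).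
pose proof (proj1 (continuous_eps x t) cx _ He') as Hx.
pose proof (proj1 (continuous_eps y t) cy _ He') as Hy.
generalize (filter_and _ _ Hx Hy). apply filter_imp. intros s [H1 H2].
eapply Rle_lt_trans; [apply HP |].
replace e with (L * (e / (2 * L) + e / (2 * L))) by (field; lra).
apply Rmult_lt_compat_l; lra.
Qed.

Lemma is_derive_RInt_continuous (f : R -> R) (c t : R) :
  (forall s, continuous f s) -> is_derive (fun t => c + RInt f 0 t) t (f t).
Proof.
intros cf. replace (f t) with (0 + f t) by ring.
apply (is_derive_plus (K := R_AbsRing) (V := R_NormedModule) (fun _ => c) (fun t => RInt f 0 t)).
- apply (is_derive_const (K := R_AbsRing) (V := R_NormedModule)).
- apply (is_derive_RInt (V := R_NormedModule) f _ 0); [| apply cf].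
  apply filter_forall. intros s. apply (RInt_correct (V := R_CompleteNormedModule)).
  apply (ex_RInt_continuous (V := R_CompleteNormedModule)). auto.
Qed.

(** The integrand is frozen at negative times, so that each iterate extends affinely to the left
    of [0] and the solution has a two-sided derivative at [0]. *)
Fixpoint picard (P Q : R -> R -> R) (x0 y0 : R) (n : nat) : (R -> R) * (R -> R) :=
  match n with
  | O => (fun _ => x0, fun _ => y0)
  | S m =>
    let x := fst (picard P Q x0 y0 m) in
    let y := snd (picard P Q x0 y0 m) in
    (fun t => x0 + RInt (fun s => P (x (Rmax 0 s)) (y (Rmax 0 s))) 0 t,
     fun t => y0 + RInt (fun s => Q (x (Rmax 0 s)) (y (Rmax 0 s))) 0 t)
  end.

(** The iterates contract by [1 / 2] per step for the weight [exp (- 4 L t)], so they converge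
    locally uniformly, and the integral recursion passes to the limit. *)
Theorem picard_lindelof (P Q : R -> R -> R) (L x0 y0 : R) :
  0 < L ->
  (forall u v u' v', Rabs (P u v - P u' v') <= L * (Rabs (u - u') + Rabs (v - v'))) ->
  (forall u v u' v', Rabs (Q u v - Q u' v') <= L * (Rabs (u - u') + Rabs (v - v'))) ->
  exists x y : R -> R, x 0 = x0 /\ y 0 = y0 /\
    forall t, 0 <= t ->
      is_derive x t (P (x t) (y t)) /\ is_derive y t (Q (x t) (y t)).
Proof.
intros HL HP HQ.
set (X := fun n => fst (picard P Q x0 y0 n)).
set (Y := fun n => snd (picard P Q x0 y0 n)).
assert (XS : forall n t, X (S n) t =
  x0 + RInt (fun s => P (X n (Rmax 0 s)) (Y n (Rmax 0 s))) 0 t) by reflexivity.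
assert (YS : forall n t, Y (S n) t =
  y0 + RInt (fun s => Q (X n (Rmax 0 s)) (Y n (Rmax 0 s))) 0 t) by reflexivity.
assert (cXY : forall n, (forall t, continuous (X n) t) /\ (forall t, continuous (Y n) t)).
{ induction n as [| n [IHx IHy]].
  - split; intros t; apply continuous_const.
  - split; intros t; apply (ex_derive_continuous (V := R_NormedModule)); eexists;
      apply is_derive_RInt_continuous; intros s;
      apply continuous_lipschitz2 with L; auto using continuous_clip. }
assert (cPn : forall n t, continuous (fun s => P (X n (Rmax 0 s)) (Y n (Rmax 0 s))) t).
{ intros n t. destruct (cXY n). apply continuous_lipschitz2 with L; auto using continuous_clip. }
assert (cQn : forall n t, continuous (fun s => Q (X n (Rmax 0 s)) (Y n (Rmax 0 s))) t).
{ intros n t. destruct (cXY n). apply continuous_lipschitz2 with L; auto using continuous_clip. }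
set (k := 4 * L). assert (Hk : 0 < k) by (unfold k; lra).
set (M := Rabs (P x0 y0) + Rabs (Q x0 y0)).
assert (HM : 0 <= M).
{ unfold M. pose proof (Rabs_pos (P x0 y0)). pose proof (Rabs_pos (Q x0 y0)). lra. }
assert (incr : forall n t, 0 <= t ->
  Rabs (X (S n) t - X n t) + Rabs (Y (S n) t - Y n t) <= M / k * (1/2)^n * exp (k * t)).
{ induction n as [| n IHn]; intros t Ht.
  - rewrite XS, YS. unfold X, Y; cbn [picard fst snd].
    rewrite !RInt_const. unfold scal; simpl; unfold mult; simpl.
    replace (x0 + (t - 0) * P x0 y0 - x0) with (t * P x0 y0) by ring.
    replace (y0 + (t - 0) * Q x0 y0 - y0) with (t * Q x0 y0) by ring.
    rewrite !Rabs_mult, (Rabs_pos_eq t Ht), Rmult_1_r.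
    pose proof (exp_ineq1_le (k * t)) as He.
    replace (t * Rabs (P x0 y0) + t * Rabs (Q x0 y0)) with (M / k * (k * t))
      by (unfold M; field; lra).
    apply Rmult_le_compat_l; [apply Rdiv_le_0_compat; lra | lra].
  - rewrite !(XS (S n)), !(YS (S n)), !(XS n), !(YS n).
    set (C := L * (M / k * (1/2)^n)).
    assert (HPP : forall s, 0 <= s <= t ->
      Rabs (P (X (S n) (Rmax 0 s)) (Y (S n) (Rmax 0 s)) - P (X n (Rmax 0 s)) (Y n (Rmax 0 s)))
        <= C * exp (k * s)).
    { intros s Hs. rewrite Rmax_right by lra. eapply Rle_trans; [apply HP |].
      unfold C. rewrite Rmult_assoc. apply Rmult_le_compat_l; [lra | apply IHn; lra]. }
    assert (HQQ : forall s, 0 <= s <= t ->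
      Rabs (Q (X (S n) (Rmax 0 s)) (Y (S n) (Rmax 0 s)) - Q (X n (Rmax 0 s)) (Y n (Rmax 0 s)))
        <= C * exp (k * s)).
    { intros s Hs. rewrite Rmax_right by lra. eapply Rle_trans; [apply HQ |].
      unfold C. rewrite Rmult_assoc. apply Rmult_le_compat_l; [lra | apply IHn; lra]. }
    pose proof (RInt_exp_close _ _ C k t Hk Ht (cPn (S n)) (cPn n) HPP) as H1.
    pose proof (RInt_exp_close _ _ C k t Hk Ht (cQn (S n)) (cQn n) HQQ) as H2.
    assert (cancel : forall z r r', z + r - (z + r') = r - r') by (intros; ring).
    rewrite !cancel.
    replace (M / k * (1/2)^(S n) * exp (k * t)) with (C / k * exp (k * t) + C / k * exp (k * t)).
    2: { unfold C, k. simpl. field. lra. }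
    apply Rplus_le_compat; assumption. }
assert (c0 : forall t, 0 <= Rmax 0 t) by (intros t; apply Rmax_l).
assert (HX : forall t n, Rabs (X (S n) (Rmax 0 t) - X n (Rmax 0 t))
                         <= M / k * exp (k * Rmax 0 t) * (1/2)^n).
{ intros t n. pose proof (incr n _ (c0 t)) as H.
  pose proof (Rabs_pos (Y (S n) (Rmax 0 t) - Y n (Rmax 0 t))).
  replace (M / k * exp (k * Rmax 0 t) * (1/2)^n)
    with (M / k * (1/2)^n * exp (k * Rmax 0 t)) by ring. lra. }
assert (HY : forall t n, Rabs (Y (S n) (Rmax 0 t) - Y n (Rmax 0 t))
                         <= M / k * exp (k * Rmax 0 t) * (1/2)^n).
{ intros t n. pose proof (incr n _ (c0 t)) as H.
  pose proof (Rabs_pos (X (S n) (Rmax 0 t) - X n (Rmax 0 t))).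
  replace (M / k * exp (k * Rmax 0 t) * (1/2)^n)
    with (M / k * (1/2)^n * exp (k * Rmax 0 t)) by ring. lra. }
set (u := fun t => proj1_sig (geometric_limit (fun n => X n (Rmax 0 t)) _ (HX t))).
set (v := fun t => proj1_sig (geometric_limit (fun n => Y n (Rmax 0 t)) _ (HY t))).
set (A := fun t => 2 * (M / k * exp (k * Rmax 0 t))).
assert (Hu : forall t n, Rabs (u t - X n (Rmax 0 t)) <= A t * (1/2)^n).
{ intros t n. unfold u. destruct geometric_limit as [l Hl]. apply Hl. }
assert (Hv : forall t n, Rabs (v t - Y n (Rmax 0 t)) <= A t * (1/2)^n).
{ intros t n. unfold v. destruct geometric_limit as [l Hl]. apply Hl. }
clearbody u v. clear HX HY.
assert (HMk : 0 <= M / k) by (apply Rdiv_le_0_compat; lra).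
assert (Amono : forall s t, s <= t -> A s <= A t).
{ intros s t Hst. unfold A. apply Rmult_le_compat_l; [lra |].
  apply Rmult_le_compat_l; [exact HMk |].
  assert (Rmax 0 s <= Rmax 0 t) by (apply Rle_max_compat_l; exact Hst).
  assert (k * Rmax 0 s <= k * Rmax 0 t) by (apply Rmult_le_compat_l; lra).
  destruct (Req_dec (k * Rmax 0 s) (k * Rmax 0 t)) as [-> |]; [lra |].
  left. apply exp_increasing. lra. }
assert (half : forall n, 0 <= (1/2)^n) by (intros n; apply pow_le; lra).
assert (climit : forall (w : R -> R) (Z : nat -> R -> R),
  (forall n t, continuous (Z n) t) ->
  (forall t n, Rabs (w t - Z n (Rmax 0 t)) <= A t * (1/2)^n) ->
  forall t, continuous w t).
{ intros w Z cZ Hw t. apply continuous_eps. intros e He.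
  assert (HA : 0 <= A (t + 1)).
  { unfold A. apply Rmult_le_pos; [lra |]. apply Rmult_le_pos; [exact HMk |].
    left; apply exp_pos. }
  assert (Hn : exists n, A (t + 1) * (1/2)^n < e / 3).
  { apply Classical_Prop.NNPP. intros Hno.
    enough (e / 3 <= 0) by lra. apply le_of_geometric with (A (t + 1)).
    intros n. apply Rnot_lt_le. intros Hlt. apply Hno. exists n. exact Hlt. }
  destruct Hn as [n Hn].
  assert (He3 : 0 < e / 3) by lra.
  pose proof (proj1 (continuous_eps _ t) (continuous_clip (Z n) t (cZ n)) _ He3) as H1.
  assert (H2 : locally t (fun s => s <= t + 1)).
  { exists (mkposreal 1 Rlt_0_1). intros s Hs. change (Rabs (s - t) < 1) in Hs.
    apply Rabs_lt_between in Hs. lra. }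
  generalize (filter_and _ _ H1 H2). apply filter_imp. intros s [Hs1 Hs2].
  pose proof (Rle_trans _ _ _ (Hw s n) (Rmult_le_compat_r _ _ _ (half n) (Amono s (t + 1) Hs2))) as W1.
  pose proof (Rle_trans _ _ _ (Hw t n) (Rmult_le_compat_r _ _ _ (half n) (Amono t (t + 1) ltac:(lra)))) as W2.
  apply Rabs_lt_between in Hs1. apply Rabs_le_between in W1, W2.
  apply Rabs_lt_between. lra. }
assert (cu : forall t, continuous u t) by (apply (climit u X); [exact (fun n => proj1 (cXY n)) | exact Hu]).
assert (cv : forall t, continuous v t) by (apply (climit v Y); [exact (fun n => proj2 (cXY n)) | exact Hv]).
(* Shared by the two components: the integral recursion of the iterates holds in the limit. *)
assert (fixpt : forall (G : R -> R -> R) (w : R -> R) (Z : nat -> R -> R) (z0 : R),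
  (forall u v u' v', Rabs (G u v - G u' v') <= L * (Rabs (u - u') + Rabs (v - v'))) ->
  (forall n t, continuous (fun s => G (X n (Rmax 0 s)) (Y n (Rmax 0 s))) t) ->
  (forall n t, Z (S n) t = z0 + RInt (fun s => G (X n (Rmax 0 s)) (Y n (Rmax 0 s))) 0 t) ->
  (forall t n, Rabs (w t - Z n (Rmax 0 t)) <= A t * (1/2)^n) ->
  forall t, 0 <= t -> w t = z0 + RInt (fun s => G (u s) (v s)) 0 t).
{ intros G w Z z0 HG cG ZS Hw t Ht.
  assert (cGuv : forall s, continuous (fun s => G (u s) (v s)) s).
  { intros s. apply continuous_lipschitz2 with L; auto. }
  enough (Rabs (w t - (z0 + RInt (fun s => G (u s) (v s)) 0 t)) <= 0) as H.
  { pose proof (Rabs_pos (w t - (z0 + RInt (fun s => G (u s) (v s)) 0 t))).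
    apply Rminus_diag_uniq, Rabs_eq_0. lra. }
  apply le_of_geometric with (2 * A t). intros n.
  pose proof (Hw t (S n)) as H1. rewrite Rmax_right in H1 by exact Ht. rewrite ZS in H1.
  assert (H2 : forall s, 0 <= s <= t ->
     Rabs (G (X n (Rmax 0 s)) (Y n (Rmax 0 s)) - G (u s) (v s))
       <= L * (4 * (M / k) * (1/2)^n) * exp (k * s)).
  { intros s Hs. rewrite Rabs_minus_sym. eapply Rle_trans; [apply HG |].
    pose proof (Hu s n) as U. pose proof (Hv s n) as V.
    unfold A in U, V. rewrite (Rmax_right 0 s) in * by lra.
    rewrite (Rmult_assoc L). apply Rmult_le_compat_l; lra. }
  assert (H3 : Rabs (RInt (fun s : R => G (X n (Rmax 0 s)) (Y n (Rmax 0 s))) 0 t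
                     - RInt (fun s : R => G (u s) (v s)) 0 t)
               <= L * (4 * (M / k) * (1/2)^n) / k * exp (k * t))
    by exact (RInt_exp_close _ _ _ k t Hk Ht (cG n) cGuv H2).
  replace (L * (4 * (M / k) * (1/2)^n) / k * exp (k * t)) with (A t / 2 * (1/2)^n) in H3.
  2: { unfold A. rewrite Rmax_right by exact Ht. unfold k. field. lra. }
  assert (0 <= A t * (1/2)^n).
  { apply Rle_trans with (2 := Hw t n). apply Rabs_pos. }
  rewrite <- tech_pow_Rmult in H1.
  apply Rabs_le_between in H1, H3. apply Rabs_le_between. lra. }
pose proof (fixpt P u X x0 HP cPn XS Hu) as Fu.
pose proof (fixpt Q v Y y0 HQ cQn YS Hv) as Fv.
exists (fun t => x0 + RInt (fun s => P (u s) (v s)) 0 t),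
       (fun t => y0 + RInt (fun s => Q (u s) (v s)) 0 t).
split; [| split].
- rewrite RInt_point. apply Rplus_0_r.
- rewrite RInt_point. apply Rplus_0_r.
- intros t Ht. rewrite <- (Fu t Ht), <- (Fv t Ht).
  split; apply (is_derive_RInt_continuous (fun s => _ (u s) (v s)));
    intros s; apply continuous_lipschitz2 with L; auto.
Qed.

(** * The limit system and its perturbations *)

Lemma exp_nondecreasing (u v : R) : u <= v -> exp u <= exp v.
Proof.
intros [H | ->]; [left; apply exp_increasing; exact H | apply Rle_refl].
Qed.

Definition first_integral (a b x y : R) : R := (y + b - a * x ^ 2) * exp (- (y / b)).

(** The exponential makes the part [y > 0] of a superlevel set bounded; the factor
    [y + b - a x^2] must be positive, which bounds [y] from below and [x] in terms of [y]. *)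
Lemma first_integral_region (a b c : R) :
  0 < a -> 0 < b -> 0 < c ->
  exists N, 0 < N /\ forall x y, c <= first_integral a b x y ->
    Rabs x <= N /\ Rabs y <= N /\ - b <= y /\ a * x ^ 2 <= y + b.
Proof.
intros Ha Hb Hc.
set (Y := 4 * b ^ 2 / c + b).
assert (Hbc : 0 <= 4 * b ^ 2 / c) by (apply Rdiv_le_0_compat; nra).
assert (HY : b <= Y) by (unfold Y; lra).
assert (HYa : 0 <= Y / a) by (apply Rdiv_le_0_compat; lra).
exists (1 + Y / a + Y). split; [lra |].
intros x y H. unfold first_integral in H.
pose proof (exp_pos (- (y / b))) as He.
assert (Hpar : a * x ^ 2 <= y + b) by nra.
assert (Hx2 : 0 <= a * x ^ 2) by nra.
assert (Hy : y <= 4 * b ^ 2 / c).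
{ destruct (Rle_lt_dec y 0) as [Hy0 | Hy0]; [lra |].
  set (s := y / b) in *.
  assert (Hys : y = b * s) by (unfold s; field; lra).
  assert (Hs : 0 < s) by (unfold s; apply Rdiv_lt_0_compat; lra).
  clearbody s.
  (* A quadratic lower bound of exp s is enough to beat the linear factor y + b. *)
  assert (Hexp : (1 + s / 2) ^ 2 * exp (- s) <= 1).
  { replace (- s) with (- (s / 2) + - (s / 2)) by field. rewrite exp_plus.
    assert ((1 + s / 2) * exp (- (s / 2)) <= 1).
    { rewrite exp_Ropp. pose proof (exp_pos (s / 2)). pose proof (exp_ineq1_le (s / 2)).
      apply Rmult_le_reg_r with (exp (s / 2)); [assumption |].
      rewrite Rmult_assoc, Rinv_l by lra. lra. }
    pose proof (exp_pos (- (s / 2))).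
    assert (0 <= (1 + s / 2) * exp (- (s / 2))) by nra.
    replace ((1 + s / 2) ^ 2 * (exp (- (s / 2)) * exp (- (s / 2))))
      with (((1 + s / 2) * exp (- (s / 2))) * ((1 + s / 2) * exp (- (s / 2)))) by ring.
    nra. }
  assert (H1 : c <= b * (1 + s) * exp (- s)) by nra.
  assert (H2 : c * (1 + s / 2) ^ 2 <= b * (1 + s)).
  { apply Rle_trans with (b * (1 + s) * exp (- s) * (1 + s / 2) ^ 2).
    - apply Rmult_le_compat_r; nra.
    - replace (b * (1 + s) * exp (- s) * (1 + s / 2) ^ 2)
        with (b * (1 + s) * ((1 + s / 2) ^ 2 * exp (- s))) by ring. nra. }
  assert (H3 : c * (1 + s / 2) <= 2 * b) by nra.
  apply Rmult_le_reg_l with c; [exact Hc |].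
  replace (c * (4 * b ^ 2 / c)) with (4 * b ^ 2) by (field; lra). subst y. nra. }
assert (Habs : Rabs y <= Y) by (apply Rabs_le; unfold Y; lra).
repeat split; try lra.
assert (Hx : x ^ 2 <= Y / a).
{ apply Rmult_le_reg_l with a; [exact Ha |].
  replace (a * (Y / a)) with Y by (field; lra). unfold Y. lra. }
apply Rabs_le. nra.
Qed.

(** Minus the angular momentum [x y' - y x'] of the limit system
    [x' = y - a x^2, y' = - 2 a b x]. *)
Definition turning (a b x y : R) : R := 2 * a * b * x ^ 2 + y ^ 2 - a * x ^ 2 * y.

(** For [y < b] the turning rate dominates [y ^ 2 + a b x ^ 2], and staying below the level [c']
    keeps away from the origin, where the first integral attains its maximum [b].  For [y >= b]
    the bound [a x ^ 2 <= y + b] of the superlevel set is what excludes a negative rate. *)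
Lemma turning_pos (a b c c' : R) :
  0 < a -> 0 < b -> 0 < c -> c' < b ->
  exists q, 0 < q /\ forall x y, c <= first_integral a b x y <= c' -> q <= turning a b x y.
Proof.
intros Ha Hb Hc Hc'.
assert (He : 0 < exp 1) by apply exp_pos.
exists (Rmin (b ^ 2) (b * (b - c') / exp 1)). split.
{ apply Rmin_glb_lt; [nra |]. apply Rdiv_lt_0_compat; nra. }
intros x y [H H'].
destruct (first_integral_region a b c Ha Hb Hc) as [N [_ HN]].
destruct (HN x y H) as [_ [_ [Hyb Hpar]]]. clear N HN.
unfold turning. assert (Hx2 : 0 <= a * x ^ 2) by nra.
destruct (Rle_lt_dec b y) as [Hby | Hby].
- eapply Rle_trans; [apply Rmin_l |].
  (* Beyond y = 2 b insert a x^2 <= y + b: the rate is at least b y + 2 b^2. *)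
  destruct (Rle_lt_dec y (2 * b)); nra.
- eapply Rle_trans; [apply Rmin_r |].
  unfold first_integral in H'.
  set (s := y / b) in *.
  assert (Hys : y = b * s) by (unfold s; field; lra).
  clearbody s.
  assert (Hs : -1 <= s <= 1) by nra.
  assert (E1 : 1 - s <= exp (- s)) by (pose proof (exp_ineq1_le (- s)); lra).
  assert (E2 : exp (- s) <= exp 1).
  { apply exp_nondecreasing. lra. }
  assert (E3 : 1 <= exp 1) by (pose proof (exp_ineq1_le 1); lra).
  (* Bounds the drop of the first integral below b by a quadratic form, through
     (1 + s) exp (- s) >= 1 - s^2. *)
  assert (K1 : b - c' <= b * s ^ 2 + exp 1 * (a * x ^ 2)).
  { assert ((1 + s) * (1 - s) <= (1 + s) * exp (- s)) by nra.
    assert (a * x ^ 2 * exp (- s) <= a * x ^ 2 * exp 1) by nra. nra. }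
  apply Rmult_le_reg_r with (exp 1); [exact He |].
  replace (b * (b - c') / exp 1 * exp 1) with (b * (b - c')) by (field; lra).
  assert (b * (b - c') <= y ^ 2 + exp 1 * (a * b * x ^ 2)) by (subst y; nra).
  assert (y ^ 2 <= exp 1 * y ^ 2) by nra.
  assert (y ^ 2 + a * b * x ^ 2 <= 2 * a * b * x ^ 2 + y ^ 2 - a * x ^ 2 * y) by nra.
  apply Rle_trans with (exp 1 * (y ^ 2 + a * b * x ^ 2)); [lra |].
  rewrite (Rmult_comm _ (exp 1)). apply Rmult_le_compat_l; lra.
Qed.

(** The error bound is only asked for where the first integral is at least [c], that is, in a
    bounded region fixed in advance: a perturbation of the limit field is small on bounded sets
    only, and that the orbit stays in the region is a conclusion. *)
Definition almost_orbit (a b c d S : R) (x y dx dy : R -> R) : Prop :=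
  forall t, 0 <= t <= S ->
    is_derive x t (dx t) /\ is_derive y t (dy t) /\
    (c <= first_integral a b (x t) (y t) ->
     Rabs (dx t - (y t - a * x t ^ 2)) <= d /\ Rabs (dy t + 2 * a * b * x t) <= d).

(** The first integral is constant for the limit system, so its derivative is linear in the error;
    if the drift accumulated up to [S] cannot reach the level [c], the region where this estimate
    is valid is never left. *)
Lemma first_integral_drift (a b c : R) :
  0 < a -> 0 < b -> 0 < c ->
  exists D, 0 < D /\ forall d S x y dx dy,
    0 <= d -> almost_orbit a b c d S x y dx dy ->
    c < first_integral a b (x 0) (y 0) - D * d * S ->
    forall t, 0 <= t <= S ->
      Rabs (first_integral a b (x t) (y t) - first_integral a b (x 0) (y 0)) <= D * d * S.
Proof.
intros Ha Hb Hc.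
destruct (first_integral_region a b c Ha Hb Hc) as [N [HN Hreg]].
set (D := exp 1 * (2 * a * N + (N + b) / b)).
assert (He1 : 0 < exp 1) by apply exp_pos.
assert (HNb : 0 < (N + b) / b) by (apply Rdiv_lt_0_compat; lra).
assert (HD : 0 < D) by (unfold D; apply Rmult_lt_0_compat; nra).
exists D. split; [exact HD |].
intros d S x y dx dy Hd Horb Hstart.
set (I := fun t => first_integral a b (x t) (y t)).
set (dI := fun t => exp (- (y t / b)) *
   (- (2 * a * x t * dx t) - (y t - a * x t ^ 2) / b * dy t)).
assert (HdI : forall t, 0 <= t <= S -> is_derive I t (dI t)).
{ intros t Ht. destruct (Horb t Ht) as [Hx [Hy _]]. unfold I, first_integral, dI.
  assert (ex_derive x t) by (eexists; exact Hx).
  assert (ex_derive y t) by (eexists; exact Hy).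
  auto_derive; [tauto |].
  replace (Derive (fun x0 : R => x x0) t) with (dx t) by (symmetry; apply is_derive_unique; exact Hx).
  replace (Derive (fun x0 : R => y x0) t) with (dy t) by (symmetry; apply is_derive_unique; exact Hy).
  simpl. unfold Rdiv. field. lra. }
assert (Hrate : forall t, 0 <= t <= S -> c <= I t -> Rabs (dI t) <= D * d).
{ intros t Ht HI. destruct (Horb t Ht) as [_ [_ Herr]].
  destruct (Herr HI) as [Ex Ey].
  destruct (Hreg _ _ HI) as [Bx [By [Hyb Hpar]]].
  assert (EdI : dI t = - (exp (- (y t / b)) *
    (2 * a * x t * (dx t - (y t - a * x t ^ 2)) + (y t - a * x t ^ 2) / b * (dy t + 2 * a * b * x t)))).
  { unfold dI. field. lra. }
  rewrite EdI, Rabs_Ropp, Rabs_mult, (Rabs_pos_eq (exp _)) by (left; apply exp_pos).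
  unfold D. rewrite (Rmult_assoc (exp 1)). apply Rmult_le_compat.
  - left; apply exp_pos.
  - apply Rabs_pos.
  - assert (- (y t / b) <= 1).
    { replace 1 with (- (- b / b)) by (field; lra). apply Ropp_le_contravar.
      apply Rmult_le_compat_r; [left; apply Rinv_0_lt_compat |]; lra. }
    apply exp_nondecreasing. assumption.
  - assert (Hw : Rabs ((y t - a * x t ^ 2) / b) <= (N + b) / b).
    { unfold Rdiv. rewrite Rabs_mult, (Rabs_pos_eq (/ b)) by (left; apply Rinv_0_lt_compat; lra).
      apply Rmult_le_compat_r; [left; apply Rinv_0_lt_compat; lra |].
      assert (0 <= a * x t ^ 2) by nra.
      apply Rabs_le_between in By. apply Rabs_le. lra. }
    eapply Rle_trans; [apply Rabs_triang |].
    rewrite Rmult_plus_distr_r. apply Rplus_le_compat.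
    + rewrite Rabs_mult. apply Rmult_le_compat; try apply Rabs_pos; [| exact Ex].
      rewrite !Rabs_mult, (Rabs_pos_eq 2), (Rabs_pos_eq a) by lra.
      apply Rmult_le_compat_l; lra.
    + rewrite Rabs_mult. apply Rmult_le_compat; try apply Rabs_pos; assumption. }
assert (Hmvt : forall t, 0 <= t <= S -> (forall s, 0 < s < t -> c <= I s) ->
                Rabs (I t - I 0) <= D * d * t).
{ intros t Ht Hs. destruct (Req_dec t 0) as [-> | Ht0].
  - unfold Rminus. rewrite Rplus_opp_r, Rabs_R0. lra.
  - destruct (MVT_cor2 I dI 0 t ltac:(lra)) as [s [Es Hst]].
    { intros s Hs'. apply is_derive_Reals, HdI. lra. }
    rewrite Es, Rabs_mult, Rminus_0_r, (Rabs_pos_eq t) by lra.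
    apply Rmult_le_compat_r; [lra |]. apply Hrate; [lra | apply Hs; exact Hst]. }
assert (Hmono : forall t, 0 <= t <= S -> D * d * t <= D * d * S).
{ intros t Ht. apply Rmult_le_compat_l; [apply Rmult_le_pos |]; lra. }
intros t Ht.
destruct (first_exit (fun t => c < I t) 0 S) as [Hall | [t1 [Ht1 [Hbefore Hexit]]]].
- lra.
- unfold I. pose proof (Hmono 0 ltac:(lra)). lra.
- intros u Hu HIu.
  apply (is_derive_continuous _ _ _ (HdI u Hu) (fun z => c < z)). apply open_gt. exact HIu.
- eapply Rle_trans; [apply Hmvt | apply Hmono]; try exact Ht.
  intros s Hs. left. apply Hall. lra.
- exfalso. apply Hexit.
  assert (H : Rabs (I t1 - I 0) <= D * d * t1).
  { apply Hmvt; [lra |]. intros s Hs. left. apply Hbefore. lra. }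
  pose proof (Hmono t1 ltac:(lra)). apply Rabs_le_between in H. unfold I in *. lra.
Qed.

(** The polar angle [atan (y / x)] lies in [(- PI / 2, PI / 2)] as long as [x > 0], and it decreases
    at a speed bounded below by [turning_pos], which leaves room for a small error. *)
Lemma half_turn_time (a b c c' : R) :
  0 < a -> 0 < b -> 0 < c -> c' < b ->
  exists d0 T0, 0 < d0 /\ 0 < T0 /\ forall d S x y dx dy,
    d <= d0 -> 0 < S -> almost_orbit a b c d S x y dx dy ->
    (forall t, 0 < t <= S -> 0 < x t) ->
    (forall t, 0 <= t <= S -> c <= first_integral a b (x t) (y t) <= c') ->
    S < T0.
Proof.
intros Ha Hb Hc Hc'.
destruct (first_integral_region a b c Ha Hb Hc) as [N [HN Hreg]].
destruct (turning_pos a b c c' Ha Hb Hc Hc') as [q [Hq Hturn]].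
set (k := q / (4 * N ^ 2)).
assert (HN2 : 0 < N ^ 2) by nra.
assert (Hk : 0 < k) by (unfold k; apply Rdiv_lt_0_compat; lra).
exists (q / (4 * N)), (2 * PI / k).
pose proof PI_RGT_0 as Hpi.
split; [apply Rdiv_lt_0_compat; lra |].
split; [apply Rdiv_lt_0_compat; lra |].
intros d S x y dx dy Hd HS Horb Hxpos HI.
set (th := fun t => atan (y t / x t)).
set (dth := fun t => (x t * dy t - y t * dx t) / (x t ^ 2 + y t ^ 2)).
assert (Hder : forall t, 0 < t <= S -> is_derive th t (dth t)).
{ intros t Ht. pose proof (Hxpos t Ht) as Hx0.
  destruct (Horb t ltac:(lra)) as [Hx [Hy _]]. unfold th, dth.
  assert (ex_derive x t) by (eexists; exact Hx).
  assert (ex_derive y t) by (eexists; exact Hy).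
  auto_derive; [repeat split; try tauto; lra |].
  replace (Derive (fun x0 : R => x x0) t) with (dx t) by (symmetry; apply is_derive_unique; exact Hx).
  replace (Derive (fun x0 : R => y x0) t) with (dy t) by (symmetry; apply is_derive_unique; exact Hy).
  simpl. field. repeat split; nra. }
assert (Hspeed : forall t, 0 < t <= S -> dth t <= - k).
{ intros t Ht. pose proof (Hxpos t Ht) as Hx0.
  destruct (Horb t ltac:(lra)) as [_ [_ Herr]].
  pose proof (HI t ltac:(lra)) as HIt. destruct (Herr (proj1 HIt)) as [Ex Ey].
  destruct (Hreg _ _ (proj1 HIt)) as [Bx [By _]].
  pose proof (Hturn _ _ HIt) as Hq'. unfold turning in Hq'.
  unfold dth. set (r2 := x t ^ 2 + y t ^ 2).
  apply Rabs_le_between in Bx, By.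
  assert (Hr2 : 0 < r2 <= 2 * N ^ 2) by (unfold r2; nra).
  apply Rmult_le_reg_r with r2; [lra |].
  replace ((x t * dy t - y t * dx t) / r2 * r2) with (x t * dy t - y t * dx t) by (field; lra).
  assert (Hnum : x t * dy t - y t * dx t <= - (q / 2)).
  { set (r1 := dx t - (y t - a * x t ^ 2)) in *. set (r := dy t + 2 * a * b * x t) in *.
    replace (x t * dy t - y t * dx t) with
      (- (2 * a * b * x t ^ 2 + y t ^ 2 - a * x t ^ 2 * y t) + (x t * r - y t * r1))
      by (unfold r, r1; ring).
    assert (HdN : N * d <= q / 4).
    { apply Rle_trans with (N * (q / (4 * N))); [apply Rmult_le_compat_l; lra |].
      apply Req_le. field. lra. }
    assert (X1 : Rabs (x t * r) <= N * d).
    { rewrite Rabs_mult. apply Rmult_le_compat; try apply Rabs_pos; [| exact Ey].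
      apply Rabs_le; lra. }
    assert (X2 : Rabs (y t * r1) <= N * d).
    { rewrite Rabs_mult. apply Rmult_le_compat; try apply Rabs_pos; [| exact Ex].
      apply Rabs_le; lra. }
    apply Rabs_le_between in X1, X2. lra. }
  assert (k * r2 <= q / 2).
  { apply Rle_trans with (k * (2 * N ^ 2)); [apply Rmult_le_compat_l; lra |].
    unfold k. apply Req_le. field. lra. }
  lra. }
(* The angle is singular at time 0, where x may vanish: only the second half of [0, S] is used. *)
destruct (MVT_cor2 th dth (S / 2) S ltac:(lra)) as [s [Es Hs]].
{ intros s Hs. apply is_derive_Reals, Hder. lra. }
pose proof (Hspeed s ltac:(lra)) as Hks.
pose proof (atan_bound (y S / x S)). pose proof (atan_bound (y (S / 2) / x (S / 2))).
unfold th in Es.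
assert (k * (S / 2) < PI) by nra.
apply Rmult_lt_reg_r with k; [exact Hk |].
replace (2 * PI / k * k) with (2 * PI) by (field; lra). lra.
Qed.

Definition axis_level (b y : R) : R := (y + b) * exp (- (y / b)).

Lemma first_integral_axis (a b y : R) : first_integral a b 0 y = axis_level b y.
Proof. unfold first_integral, axis_level. f_equal. ring. Qed.

Lemma axis_level_decreasing (b u v : R) :
  0 < b -> 0 <= u < v -> axis_level b v < axis_level b u.
Proof.
intros Hb Huv. unfold axis_level.
assert (Hz : 0 < (v - u) / b) by (apply Rdiv_lt_0_compat; lra).
pose proof (exp_ineq1 ((v - u) / b) ltac:(lra)) as He.
replace (- (u / b)) with (- (v / b) + (v - u) / b) by (field; lra).
rewrite exp_plus. pose proof (exp_pos (- (v / b))).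
rewrite <- Rmult_assoc, (Rmult_comm (u + b)), Rmult_assoc, (Rmult_comm (v + b)).
apply Rmult_lt_compat_l; [assumption |].
apply Rle_lt_trans with ((u + b) * (1 + (v - u) / b)); [| apply Rmult_lt_compat_l; lra].
replace ((u + b) * (1 + (v - u) / b)) with (v + b + u * ((v - u) / b)) by (field; lra).
nra.
Qed.

(** * The half return map of a perturbation of the limit system *)

(** For [W] a rescaled field this is literally [is_Pi_plus]. *)
Definition half_return (W : R * R -> R * R) (ybar p : R) : Prop :=
  0 < ybar /\
  exists (T : R) (x y : R -> R),
    0 < T /\
    solution_on W 0 T x y /\
    x 0 = 0 /\ y 0 = ybar /\
    (forall t : R, 0 <= t <= T -> 0 <= x t) /\
    x T = 0 /\ y T = p /\ p < 0 /\
    (forall t : R, 0 < t < T -> ~ (x t = 0 /\ y t < 0)).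

Lemma clip_lipschitz (N u v : R) :
  Rabs (Rmax 0 (Rmin u N) - Rmax 0 (Rmin v N)) <= Rabs (u - v).
Proof.
unfold Rmax, Rmin; repeat destruct Rle_dec;
  unfold Rabs; repeat destruct Rcase_abs; lra.
Qed.

(** All constants are chosen from the levels of the first integral on [[y1, y2]]: an orbit that
    starts there stays between the levels [c] and [c'], hence in a box of size [N], until the
    uniform time [T0], and it must reach the axis before [T0] by [half_turn_time].  On the axis
    the point of arrival cannot be the origin, because the level of the origin is [b > c'], nor
    have [y > 0], because the flow points into [x > 0] there.  For existence, the same estimates
    are applied to a solution of the field truncated outside [0 <= x <= N]. *)
Lemma half_return_close (a b y1 y2 eta : R) :
  0 < a -> 0 < b -> 0 < y1 -> y1 <= y2 -> 0 < eta ->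
  exists d N, 0 < d /\ 0 < N /\
    forall (f g : R -> R) (L : R) (W : R * R -> R * R),
    (forall p, W p = (snd p - f (fst p), g (fst p))) ->
    f 0 = 0 ->
    (forall u v, 0 <= u <= N -> 0 <= v <= N ->
       Rabs (f u - f v) <= L * Rabs (u - v) /\ Rabs (g u - g v) <= L * Rabs (u - v)) ->
    (forall u, 0 <= u <= N ->
       Rabs (f u - a * u ^ 2) <= d /\ Rabs (g u + 2 * a * b * u) <= d) ->
    forall ybar, y1 <= ybar <= y2 ->
      (exists p, half_return W ybar p) /\
      (forall p, half_return W ybar p ->
         - b <= p /\
         Rabs (axis_level b p - axis_level b ybar) < eta).
Proof.
intros Ha Hb Hy1 Hy12 Heta.
set (h := axis_level b).
assert (h0 : h 0 = b).
{ unfold h, axis_level. unfold Rdiv. rewrite Rmult_0_l, Ropp_0, exp_0. ring. }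
assert (hdec : forall u v, 0 <= u <= v -> h v <= h u).
{ intros u v [Hu [Huv | ->]]; [| apply Rle_refl].
  left. apply axis_level_decreasing; lra. }
assert (hy1 : h y1 < b).
{ rewrite <- h0. apply axis_level_decreasing; lra. }
assert (hy2 : 0 < h y2).
{ unfold h, axis_level. apply Rmult_lt_0_compat; [lra | apply exp_pos]. }
set (c := h y2 / 2). set (c' := (h y1 + b) / 2).
assert (Hc : 0 < c) by (unfold c; lra).
assert (Hc' : c' < b) by (unfold c'; lra).
destruct (first_integral_region a b c Ha Hb Hc) as [N [HN Hreg]].
destruct (first_integral_drift a b c Ha Hb Hc) as [D [HD Hdrift]].
destruct (half_turn_time a b c c' Ha Hb Hc Hc') as [d0 [T0 [Hd0 [HT0 Hturn]]]].
set (e := Rmin (Rmin (h y2 / 4) ((b - h y1) / 4)) (eta / 2)).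
assert (He : 0 < e) by (unfold e; repeat apply Rmin_glb_lt; lra).
assert (He1 : e <= h y2 / 4) by (unfold e; eapply Rle_trans; [apply Rmin_l | apply Rmin_l]).
assert (He2 : e <= (b - h y1) / 4) by (unfold e; eapply Rle_trans; [apply Rmin_l | apply Rmin_r]).
assert (He3 : e <= eta / 2) by (unfold e; apply Rmin_r).
assert (HDT : 0 < D * T0) by (apply Rmult_lt_0_compat; lra).
(* The first integral drifts by at most e up to time T0. *)
set (d := Rmin d0 (e / (D * T0))).
assert (Hd : 0 < d) by (unfold d; apply Rmin_glb_lt; [| apply Rdiv_lt_0_compat]; lra).
assert (HDd : forall S, S <= T0 -> D * d * S <= e).
{ intros S HS. apply Rle_trans with (D * d * T0).
  - apply Rmult_le_compat_l; [apply Rmult_le_pos |]; lra.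
  - apply Rle_trans with (D * (e / (D * T0)) * T0).
    + apply Rmult_le_compat_r; [lra |]. apply Rmult_le_compat_l; [lra |]. apply Rmin_r.
    + apply Req_le. field. lra. }
exists d, N. split; [exact Hd |]. split; [exact HN |].
intros f g L W HW f0 Hlip Hclose ybar Hybar.
assert (Hstart : h y2 <= h ybar <= h y1) by (split; apply hdec; lra).
assert (control : forall S x y dx dy, S <= T0 -> almost_orbit a b c d S x y dx dy ->
  x 0 = 0 -> y 0 = ybar -> forall t, 0 <= t <= S ->
  c <= first_integral a b (x t) (y t) <= c' /\
  Rabs (first_integral a b (x t) (y t) - h ybar) < eta).
{ intros S x y dx dy HS Horb x0 y0 t Ht.
  pose proof (HDd S HS) as HeS.
  assert (Hini : first_integral a b (x 0) (y 0) = h ybar).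
  { rewrite x0, y0. apply first_integral_axis. }
  assert (H : Rabs (first_integral a b (x t) (y t) - first_integral a b (x 0) (y 0)) <= D * d * S).
  { apply (Hdrift d S x y dx dy); try assumption; [lra |].
    rewrite Hini. unfold c. lra. }
  rewrite Hini in H.
  split; [| lra]. apply Rabs_le_between in H. unfold c, c'. lra. }
assert (y_neq0 : forall u v, first_integral a b u v <= c' -> u = 0 -> v <> 0).
{ intros u v H -> ->. rewrite first_integral_axis in H. fold h in H. lra. }
split.
- set (clip := fun u => Rmax 0 (Rmin u N)).
  assert (clipN : forall u, 0 <= clip u <= N).
  { intros u. unfold clip, Rmax, Rmin. repeat destruct Rle_dec; lra. }
  assert (clip_id : forall u, 0 <= u <= N -> clip u = u).
  { intros u Hu. unfold clip. rewrite Rmin_left, Rmax_right; lra. }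
  assert (HL : 0 <= L).
  { pose proof (proj1 (Hlip 0 N ltac:(lra) ltac:(lra))) as H.
    pose proof (Rabs_pos (f 0 - f N)).
    assert (0 < Rabs (0 - N)) by (apply Rabs_pos_lt; lra). nra. }
  assert (lipc : forall k, (forall u v, 0 <= u <= N -> 0 <= v <= N ->
      Rabs (k u - k v) <= L * Rabs (u - v)) ->
      forall u v, Rabs (k (clip u) - k (clip v)) <= L * Rabs (u - v)).
  { intros k Hk u v. eapply Rle_trans; [apply Hk; apply clipN |].
    apply Rmult_le_compat_l; [exact HL | apply clip_lipschitz]. }
  pose proof (lipc f (fun u v Hu Hv => proj1 (Hlip u v Hu Hv))) as lipf.
  pose proof (lipc g (fun u v Hu Hv => proj2 (Hlip u v Hu Hv))) as lipg.
  destruct (picard_lindelof (fun u v => v - f (clip u)) (fun u _ => g (clip u)) (L + 1) 0 ybar)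
    as [x [y [x0 [y0 Hxy]]]].
  { lra. }
  { intros u v u' v'. pose proof (lipf u u') as H. pose proof (Rabs_pos (u - u')).
    pose proof (Rabs_pos (v - v')).
    replace (v - f (clip u) - (v' - f (clip u'))) with ((v - v') - (f (clip u) - f (clip u'))) by ring.
    unfold Rminus at 1. eapply Rle_trans; [apply Rabs_triang |]. rewrite Rabs_Ropp. nra. }
  { intros u v u' v'. pose proof (lipg u u') as H. pose proof (Rabs_pos (u - u')).
    pose proof (Rabs_pos (v - v')). nra. }
  assert (Horb : forall S, (forall t, 0 <= t <= S -> 0 <= x t) ->
    almost_orbit a b c d S x y (fun t => y t - f (clip (x t))) (fun t => g (clip (x t)))).
  { intros S HxS t Ht. destruct (Hxy t ltac:(lra)) as [Dx Dy].
    split; [exact Dx |]. split; [exact Dy |]. intros HI.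
    destruct (Hreg _ _ HI) as [Bx _]. apply Rabs_le_between in Bx.
    pose proof (HxS t Ht). destruct (Hclose (x t) ltac:(lra)) as [Cf Cg].
    rewrite clip_id by lra. split; [| exact Cg].
    replace (y t - f (x t) - (y t - a * x t ^ 2)) with (- (f (x t) - a * x t ^ 2)) by ring.
    rewrite Rabs_Ropp. exact Cf. }
  assert (cx : forall t, 0 <= t -> continuous x t).
  { intros t Ht. exact (is_derive_continuous x t _ (proj1 (Hxy t Ht))). }
  assert (clip0 : f (clip 0) = 0) by (rewrite clip_id by lra; exact f0).
  destruct (is_derive_pos_local x 0 _ (proj1 (Hxy 0 ltac:(lra)))) as [r [Hr [Hinit _]]].
  { rewrite x0, y0, clip0. lra. }
  rewrite x0 in Hinit.
  set (s := Rmin (r / 2) (T0 / 2)).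
  assert (Hs : 0 < s) by (unfold s; apply Rmin_glb_lt; lra).
  assert (Hs1 : s <= r / 2) by apply Rmin_l.
  assert (Hs2 : s <= T0 / 2) by apply Rmin_r.
  destruct (first_exit (fun t => 0 < x t) s T0) as [Hall | [T [HT [Hbefore Hexit]]]].
  + lra.
  + apply Hinit. lra.
  + intros t Ht Hxt. apply (cx t ltac:(lra) (fun z => 0 < z)). apply open_gt. exact Hxt.
  + exfalso.
    assert (Hpos : forall t, 0 < t <= T0 -> 0 < x t).
    { intros t Ht. destruct (Rlt_le_dec t s); [apply Hinit | apply Hall]; lra. }
    assert (Hnn : forall t, 0 <= t <= T0 -> 0 <= x t).
    { intros t Ht. destruct (Req_dec t 0) as [-> |]; [lra |]. left. apply Hpos. lra. }
    apply (Rlt_irrefl T0).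
    apply (Hturn d T0 x y _ _ (Rmin_l _ _) HT0 (Horb T0 Hnn) Hpos).
    intros t Ht. apply (control T0 x y _ _ (Rle_refl _) (Horb T0 Hnn) x0 y0 t Ht).
  + assert (Hpos : forall t, 0 < t < T -> 0 < x t).
    { intros t Ht. destruct (Rlt_le_dec t s); [apply Hinit | apply Hbefore]; lra. }
    assert (xT : x T = 0).
    { apply Rle_antisym; [lra |]. apply limit_nonneg; [lra | exact Hpos | apply cx; lra]. }
    assert (Hnn : forall t, 0 <= t <= T -> 0 <= x t).
    { intros t Ht. destruct (Req_dec t 0) as [-> |]; [lra |].
      destruct (Req_dec t T) as [-> |]; [lra |]. left. apply Hpos. lra. }
    pose proof (control T x y _ _ ltac:(lra) (Horb T Hnn) x0 y0) as Hcon.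
    assert (yT : y T < 0).
    { assert (y T <> 0) by (apply (y_neq0 (x T)); [apply Hcon; lra | exact xT]).
      enough (y T - f (clip (x T)) <= 0) by (rewrite xT, clip0 in *; lra).
      apply (derive_nonpos_at_zero x T); [lra | | exact xT | apply Hxy; lra].
      intros t Ht. left. apply Hpos. exact Ht. }
    exists (y T). split; [lra |]. exists T, x, y.
    split; [lra |]. split.
    { intros t Ht. rewrite HW. simpl.
      destruct (Hcon t Ht) as [[HI _] _]. destruct (Hreg _ _ HI) as [Bx _].
      apply Rabs_le_between in Bx. pose proof (Hnn t Ht).
      pose proof (Hxy t ltac:(lra)) as Hd'. rewrite clip_id in Hd' by lra. exact Hd'. }
    repeat split; try assumption.
    intros t Ht [Hx _]. pose proof (Hpos t Ht). lra.
- intros p [_ [T [x [y [HT [Hsol [x0 [y0 [Hnn [xT [yT [Hp Hfirst]]]]]]]]]]]].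
  assert (Horb : forall S, S <= T ->
    almost_orbit a b c d S x y (fun t => y t - f (x t)) (fun t => g (x t))).
  { intros S HS t Ht. destruct (Hsol t ltac:(lra)) as [Dx Dy]. rewrite HW in Dx, Dy.
    split; [exact Dx |]. split; [exact Dy |]. intros HI.
    destruct (Hreg _ _ HI) as [Bx _]. apply Rabs_le_between in Bx.
    pose proof (Hnn t ltac:(lra)). destruct (Hclose (x t) ltac:(lra)) as [Cf Cg].
    split; [| exact Cg].
    replace (y t - f (x t) - (y t - a * x t ^ 2)) with (- (f (x t) - a * x t ^ 2)) by ring.
    rewrite Rabs_Ropp. exact Cf. }
  destruct (Rle_lt_dec T T0) as [HTT | HTT].
  + destruct (control T x y _ _ HTT (Horb T (Rle_refl T)) x0 y0 T ltac:(lra)) as [[HI _] Hd'].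
    destruct (Hreg _ _ HI) as [_ [_ [By _]]].
    rewrite xT, yT, first_integral_axis in *. split; assumption.
  + exfalso.
    pose proof (control T0 x y _ _ (Rle_refl _) (Horb T0 (Rlt_le _ _ HTT)) x0 y0) as Hcon.
    apply (Rlt_irrefl T0).
    apply (Hturn d T0 x y _ _ (Rmin_l _ _) HT0 (Horb T0 (Rlt_le _ _ HTT))).
    * intros t Ht. destruct (Hnn t ltac:(lra)) as [| Hx0]; [assumption | exfalso].
      symmetry in Hx0.
      assert (y t <> 0) by (apply (y_neq0 (x t)); [apply Hcon; lra | exact Hx0]).
      assert (~ y t < 0) by (intros Hy; apply (Hfirst t ltac:(lra)); split; assumption).
      destruct (Hsol t ltac:(lra)) as [Dx _]. rewrite HW in Dx. simpl in Dx.
      enough (y t - f (x t) <= 0) by (rewrite Hx0, f0 in *; lra).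
      apply (derive_nonpos_at_zero x t); [lra | | exact Hx0 | exact Dx].
      intros u Hu. apply Hnn. lra.
    * intros t Ht. apply Hcon. exact Ht.
Qed.

(** * Two return relations with different parameters have no common solution *)

Lemma continuous_axis_level (b y : R) : continuous (axis_level b) y.
Proof.
apply (ex_derive_continuous (V := R_NormedModule)). unfold axis_level. auto_derive. exact I.
Qed.

Lemma axis_level_ln (b y p : R) :
  0 < b -> 0 < y -> axis_level b p = axis_level b y ->
  0 < p + b /\ ln (1 + / b * y) - ln (1 + / b * p) - / b * (y - p) = 0.
Proof.
unfold axis_level. intros Hb Hy H.
assert (Hpb : 0 < p + b).
{ apply Rmult_lt_reg_r with (exp (- (p / b))); [apply exp_pos |].
  rewrite Rmult_0_l, H. apply Rmult_lt_0_compat; [lra | apply exp_pos]. }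
split; [exact Hpb |].
apply (f_equal ln) in H.
rewrite !ln_mult, !ln_exp in H by (try apply exp_pos; lra).
assert (Hib : 0 < / b) by (apply Rinv_0_lt_compat; exact Hb).
replace (1 + / b * y) with ((y + b) * / b) by (field; lra).
replace (1 + / b * p) with ((p + b) * / b) by (field; lra).
rewrite !ln_mult by lra. unfold Rdiv in H. lra.
Qed.

(** In terms of [s = 1 / b] both equations of [axis_level_ln] say that the function [psi] below
    vanishes.  It also vanishes at [s = 0], so two positive zeros would give two critical points
    by Rolle, while a critical point solves an equation that is affine in [s]. *)
Lemma axis_level_separates (b b' y p : R) :
  0 < b -> b < b' -> 0 < y -> p <= 0 ->
  axis_level b p = axis_level b y -> axis_level b' p = axis_level b' y -> False.
Proof.
intros Hb Hbb' Hy Hp E E'.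
destruct (axis_level_ln b y p Hb Hy E) as [Hpb Hln].
destruct (axis_level_ln b' y p ltac:(lra) Hy E') as [_ Hln'].
assert (Hib : 0 < / b) by (apply Rinv_0_lt_compat; lra).
assert (Hib' : 0 < / b') by (apply Rinv_0_lt_compat; lra).
assert (Hinv : / b' < / b) by (apply Rinv_lt_contravar; nra).
assert (Hdom : forall s, 0 <= s <= / b -> 0 < 1 + s * p).
{ intros s Hs. apply Rlt_le_trans with (1 + / b * p); [| nra].
  replace (1 + / b * p) with (/ b * (p + b)) by (field; lra). nra. }
set (psi := fun s => ln (1 + s * y) - ln (1 + s * p) - s * (y - p)).
set (dpsi := fun s => y / (1 + s * y) - p / (1 + s * p) - (y - p)).
assert (Hder : forall s, 0 <= s <= / b -> derivable_pt_lim psi s (dpsi s)).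
{ intros s Hs. apply is_derive_Reals. unfold psi, dpsi. pose proof (Hdom s Hs).
  assert (0 < 1 + s * y) by nra.
  auto_derive; [tauto | field; lra]. }
assert (psi0 : psi 0 = 0).
{ unfold psi. rewrite !Rmult_0_l, Rplus_0_r, ln_1. ring. }
assert (crit : forall s, 0 < s <= / b -> dpsi s = 0 -> y <> p -> p + y + s * (p * y) = 0).
{ intros s Hs H Hyp. pose proof (Hdom s ltac:(lra)). assert (0 < 1 + s * y) by nra.
  assert (Hfac : dpsi s = s * (p - y) * (p + y + s * (p * y)) / ((1 + s * y) * (1 + s * p))).
  { unfold dpsi. field. lra. }
  rewrite Hfac in H. apply Rmult_integral in H. destruct H as [H | H].
  - apply Rmult_integral in H. destruct H as [H | H]; [| exact H].
    exfalso. apply Rmult_integral in H. destruct H; lra.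
  - exfalso. revert H. apply Rinv_neq_0_compat. nra. }
destruct (MVT_cor2 psi dpsi 0 (/ b') Hib') as [s1 [Es1 Hs1]].
{ intros s Hs. apply Hder. lra. }
destruct (MVT_cor2 psi dpsi (/ b') (/ b) Hinv) as [s2 [Es2 Hs2]].
{ intros s Hs. apply Hder. lra. }
fold (psi (/ b)) in Hln. fold (psi (/ b')) in Hln'.
rewrite Hln', psi0 in Es1. rewrite Hln, Hln' in Es2.
assert (C1 : p + y + s1 * (p * y) = 0) by (apply crit; nra).
assert (C2 : p + y + s2 * (p * y) = 0) by (apply crit; nra).
assert (Hz : (s1 - s2) * (p * y) = 0) by lra.
apply Rmult_integral in Hz. destruct Hz as [Hz | Hz]; [lra |].
rewrite Hz in C1. replace p with (- y) in Hz by lra. nra.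
Qed.

(** Compactness of the rectangle; near each of its points the gap stays above a positive number,
    and the radius of the neighbourhood is taken below that number so that a uniform radius is also
    a uniform lower bound. *)
Lemma uniform_gap (h1 h2 : R -> R) (l r l' r' : R) :
  (forall t, continuous h1 t) -> (forall t, continuous h2 t) ->
  (forall p y, l <= p <= r -> l' <= y <= r' -> h1 p = h1 y -> h2 p = h2 y -> False) ->
  exists m, 0 < m /\ forall p y, l <= p <= r -> l' <= y <= r' ->
    m <= Rabs (h1 p - h1 y) + Rabs (h2 p - h2 y).
Proof.
intros c1 c2 Hsep.
set (gap := fun p y => Rabs (h1 p - h1 y) + Rabs (h2 p - h2 y)).
assert (Hloc : forall u v, exists d : posreal, l <= u <= r -> l' <= v <= r' ->
   forall p y, Rabs (p - u) < d -> Rabs (y - v) < d -> d <= gap p y).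
{ intros u v.
  destruct (Classical_Prop.classic (l <= u <= r /\ l' <= v <= r')) as [[Hu Hv] | Hout].
  2: { exists (mkposreal 1 Rlt_0_1). tauto. }
  assert (Hpos : 0 < gap u v).
  { unfold gap. pose proof (Rabs_pos (h1 u - h1 v)). pose proof (Rabs_pos (h2 u - h2 v)).
    destruct (Req_dec (h1 u) (h1 v)) as [E1 | N1].
    - destruct (Req_dec (h2 u) (h2 v)) as [E2 | N2].
      + exfalso. exact (Hsep u v Hu Hv E1 E2).
      + pose proof (Rabs_pos_lt (h2 u - h2 v) ltac:(lra)). lra.
    - pose proof (Rabs_pos_lt (h1 u - h1 v) ltac:(lra)). lra. }
  assert (He : 0 < gap u v / 8) by lra.
  destruct (proj1 (continuous_eps h1 u) (c1 u) _ He) as [d1 D1].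
  destruct (proj1 (continuous_eps h1 v) (c1 v) _ He) as [d2 D2].
  destruct (proj1 (continuous_eps h2 u) (c2 u) _ He) as [d3 D3].
  destruct (proj1 (continuous_eps h2 v) (c2 v) _ He) as [d4 D4].
  set (d := Rmin (Rmin (Rmin d1 d2) (Rmin d3 d4)) (gap u v / 2)).
  assert (Hd : 0 < d) by (unfold d; repeat apply Rmin_glb_lt; try apply cond_pos; lra).
  assert (Hle : d <= d1 /\ d <= d2 /\ d <= d3 /\ d <= d4 /\ d <= gap u v / 2).
  { unfold d. repeat split.
    - do 3 (eapply Rle_trans; [apply Rmin_l |]). apply Rle_refl.
    - do 2 (eapply Rle_trans; [apply Rmin_l |]). apply Rmin_r.
    - eapply Rle_trans; [apply Rmin_l |]. eapply Rle_trans; [apply Rmin_r |]. apply Rmin_l.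
    - eapply Rle_trans; [apply Rmin_l |]. eapply Rle_trans; [apply Rmin_r |]. apply Rmin_r.
    - apply Rmin_r. }
  exists (mkposreal d Hd). intros _ _ p y Hp Hy. simpl in *.
  assert (B1 : Rabs (h1 p - h1 u) < gap u v / 8)
    by (apply D1; change (Rabs (p - u) < d1); lra).
  assert (B2 : Rabs (h1 y - h1 v) < gap u v / 8)
    by (apply D2; change (Rabs (y - v) < d2); lra).
  assert (B3 : Rabs (h2 p - h2 u) < gap u v / 8)
    by (apply D3; change (Rabs (p - u) < d3); lra).
  assert (B4 : Rabs (h2 y - h2 v) < gap u v / 8)
    by (apply D4; change (Rabs (y - v) < d4); lra).
  apply Rle_trans with (gap u v / 2); [lra |].
  pose proof (Rabs_triang_inv (h1 u - h1 v) ((h1 u - h1 p) + (h1 y - h1 v))) as T1.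
  pose proof (Rabs_triang_inv (h2 u - h2 v) ((h2 u - h2 p) + (h2 y - h2 v))) as T2.
  replace (h1 u - h1 v - (h1 u - h1 p + (h1 y - h1 v))) with (h1 p - h1 y) in T1 by ring.
  replace (h2 u - h2 v - (h2 u - h2 p + (h2 y - h2 v))) with (h2 p - h2 y) in T2 by ring.
  pose proof (Rabs_triang (h1 u - h1 p) (h1 y - h1 v)).
  pose proof (Rabs_triang (h2 u - h2 p) (h2 y - h2 v)).
  rewrite (Rabs_minus_sym (h1 p)) in B1. rewrite (Rabs_minus_sym (h2 p)) in B3.
  unfold gap in *. lra. }
destruct (compactness_value_2d l r l' r'
  (fun u v => proj1_sig (constructive_indefinite_description _ (Hloc u v)))) as [m Hm].
exists m. split; [apply cond_pos |].
intros p y Hp Hy. apply Rnot_lt_le. intros Hlt.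
apply (Hm p y Hp Hy). intros [u [v [Hu [Hv [Hpu [Hyv Hmd]]]]]].
destruct (constructive_indefinite_description _ (Hloc u v)) as [d Hd]. simpl in *.
pose proof (Hd Hu Hv p y Hpu Hyv) as H. unfold gap in H. lra.
Qed.

(** * The rescaled system near the limit *)

Lemma linear_approx (k : R -> R) (e : R) :
  ex_derive k 0 -> k 0 = 0 -> 0 < e ->
  exists r, 0 < r /\ forall t, Rabs t < r -> Rabs (k t - Derive k 0 * t) <= e * Rabs t.
Proof.
intros Hk k0 He. apply Derive_correct, is_derive_Reals in Hk.
destruct (Hk e He) as [r Hr]. exists r. split; [apply cond_pos |].
intros t Ht. destruct (Req_dec t 0) as [-> | Ht0].
- rewrite k0, Rmult_0_r, Rminus_0_r, Rabs_R0, Rmult_0_r. apply Rle_refl.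
- specialize (Hr t Ht0 Ht). rewrite Rplus_0_l, k0, Rminus_0_r in Hr.
  replace (k t - Derive k 0 * t) with ((k t / t - Derive k 0) * t) by (field; exact Ht0).
  rewrite Rabs_mult. apply Rmult_le_compat_r; [apply Rabs_pos | lra].
Qed.

Lemma smooth_is_derive (F : R -> R) (x : R) : smooth F -> is_derive F x (Derive F x).
Proof. intros H. apply Derive_correct. exact (H 1%nat x). Qed.

(** Obtained by integrating the first-order expansion of [Derive F]. *)
Lemma quadratic_approx (F : R -> R) (e : R) :
  smooth F -> F 0 = 0 -> Derive F 0 = 0 -> 0 < e ->
  exists r, 0 < r /\
    forall t, 0 <= t < r -> Rabs (F t - Derive_n F 2 0 / 2 * t ^ 2) <= e * t ^ 2.
Proof.
intros sF F0 dF0 He.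
set (A := Derive_n F 2 0).
destruct (linear_approx (Derive F) e (sF 2%nat 0) dF0 He) as [r [Hr Happ]].
change (Derive (Derive F) 0) with A in Happ. clearbody A.
exists r. split; [exact Hr |]. intros t Ht.
destruct (Req_dec t 0) as [-> | Ht0].
{ rewrite F0. replace (0 - A / 2 * 0 ^ 2) with 0 by (simpl; ring).
  rewrite Rabs_R0. simpl. lra. }
destruct (MVT_cor2 (fun t => F t - A / 2 * t ^ 2)
   (fun t => Derive F t - A * t) 0 t ltac:(lra)) as [s [Es Hs]].
{ intros s _. apply is_derive_Reals. pose proof (smooth_is_derive F s sF) as HF.
  auto_derive; [eexists; exact HF |].
  change (Derive (fun x => F x) s) with (Derive F s). field. }
rewrite F0 in Es.
replace (F t - A / 2 * t ^ 2)
  with (F t - A / 2 * t ^ 2 - (0 - A / 2 * 0 ^ 2)) by (simpl; ring).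
rewrite Es, Rabs_mult, Rminus_0_r, (Rabs_pos_eq t) by lra.
replace (e * t ^ 2) with (e * t * t) by ring.
apply Rmult_le_compat_r; [lra |].
pose proof (Happ s ltac:(rewrite Rabs_pos_eq; lra)) as H. rewrite (Rabs_pos_eq s) in H by lra.
eapply Rle_trans; [exact H |]. apply Rmult_le_compat_l; lra.
Qed.

Lemma smooth_lipschitz (F : R -> R) (r : R) :
  smooth F -> 0 <= r ->
  exists L, 0 <= L /\ forall u v, 0 <= u <= r -> 0 <= v <= r ->
    Rabs (F u - F v) <= L * Rabs (u - v).
Proof.
intros sF Hr.
destruct (continuity_ab_maj (fun t => Rabs (Derive F t)) 0 r Hr) as [M [HM _]].
{ intros t _. apply (continuity_pt_comp (Derive F) Rabs); [| apply Rcontinuity_abs].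
  apply continuity_pt_filterlim.
  apply (ex_derive_continuous (V := R_NormedModule)). exact (sF 2%nat t). }
exists (Rabs (Derive F M)). split; [apply Rabs_pos |].
intros u v Hu Hv.
destruct (MVT_gen F v u (Derive F)) as [s [Hs Es]].
- intros t _. apply smooth_is_derive, sF.
- intros t _. apply continuity_pt_filterlim.
  apply (ex_derive_continuous (V := R_NormedModule)). exact (sF 1%nat t).
- rewrite Es, Rabs_mult. apply Rmult_le_compat_r; [apply Rabs_pos |]. apply HM.
  revert Hs. unfold Rmin, Rmax. destruct Rle_dec; lra.
Qed.

Definition rescaled_F (F : R -> R) (eps x : R) : R :=
  if Req_dec_T eps 0 then Derive_n F 2 0 / 2 * x ^ 2 else F (eps * x) / eps ^ 2.

Definition rescaled_G (G : R -> R) (eps alpha x : R) : R :=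
  if Req_dec_T eps 0 then alpha + Derive G 0 * x else alpha + G (eps * x) / eps.

Lemma rescaled_field_split (F G : R -> R) (eps alpha : R) (p : R * R) :
  rescaled_field F G eps alpha p = (snd p - rescaled_F F eps (fst p), rescaled_G G eps alpha (fst p)).
Proof. unfold rescaled_field, rescaled_F, rescaled_G. destruct Req_dec_T; reflexivity. Qed.

Lemma rescaled_F_0 (F : R -> R) (eps : R) : F 0 = 0 -> rescaled_F F eps 0 = 0.
Proof.
intros F0. unfold rescaled_F. destruct Req_dec_T.
- simpl. ring.
- rewrite Rmult_0_r, F0. unfold Rdiv. ring.
Qed.

Lemma rescaled_F_close (F : R -> R) (N d : R) :
  smooth F -> F 0 = 0 -> Derive F 0 = 0 -> 0 < N -> 0 < d ->
  exists eps0, 0 < eps0 /\ forall eps u, 0 <= eps <= eps0 -> 0 <= u <= N ->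
    Rabs (rescaled_F F eps u - Derive_n F 2 0 / 2 * u ^ 2) <= d.
Proof.
intros sF F0 dF0 HN Hd.
assert (HN2 : 0 < N ^ 2) by nra.
destruct (quadratic_approx F (d / N ^ 2) sF F0 dF0) as [r [Hr H]].
{ apply Rdiv_lt_0_compat; lra. }
exists (r / (2 * N)). split; [apply Rdiv_lt_0_compat; lra |].
intros eps u Heps Hu. unfold rescaled_F. destruct Req_dec_T as [E | NE].
- unfold Rminus. rewrite Rplus_opp_r, Rabs_R0. lra.
- assert (Hsmall : 0 <= eps * u < r).
  { split; [apply Rmult_le_pos; lra |].
    apply Rle_lt_trans with (r / (2 * N) * N); [apply Rmult_le_compat; lra |].
    replace (r / (2 * N) * N) with (r / 2) by (field; lra). lra. }
  specialize (H _ Hsmall).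
  assert (He2 : 0 < eps ^ 2) by nra.
  apply Rmult_le_reg_r with (eps ^ 2); [exact He2 |].
  rewrite <- (Rabs_pos_eq (eps ^ 2)) at 2 by lra. rewrite <- Rabs_mult.
  replace ((F (eps * u) / eps ^ 2 - Derive_n F 2 0 / 2 * u ^ 2) * eps ^ 2)
    with (F (eps * u) - Derive_n F 2 0 / 2 * (eps * u) ^ 2) by (field; exact NE).
  eapply Rle_trans; [exact H |].
  replace (d / N ^ 2 * (eps * u) ^ 2) with (d / N ^ 2 * u ^ 2 * eps ^ 2) by ring.
  apply Rmult_le_compat_r; [lra |].
  apply Rle_trans with (d / N ^ 2 * N ^ 2).
  + apply Rmult_le_compat_l; [apply Rdiv_le_0_compat; lra |]. apply pow_incr. lra.
  + apply Req_le. field. lra.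
Qed.

Lemma rescaled_G_close (G : R -> R) (N d : R) :
  smooth G -> G 0 = 0 -> 0 < N -> 0 < d ->
  exists eps0, 0 < eps0 /\ forall eps alpha u, 0 <= eps <= eps0 -> 0 <= u <= N ->
    Rabs (rescaled_G G eps alpha u - Derive G 0 * u) <= Rabs alpha + d.
Proof.
intros sG G0 HN Hd.
destruct (linear_approx G (d / N) (sG 1%nat 0) G0) as [r [Hr H]].
{ apply Rdiv_lt_0_compat; lra. }
exists (r / (2 * N)). split; [apply Rdiv_lt_0_compat; lra |].
intros eps alpha u Heps Hu. unfold rescaled_G. destruct Req_dec_T as [E | NE].
- replace (alpha + Derive G 0 * u - Derive G 0 * u) with alpha by ring. lra.
- assert (Hsmall : 0 <= eps * u < r).
  { split; [apply Rmult_le_pos; lra |].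
    apply Rle_lt_trans with (r / (2 * N) * N); [apply Rmult_le_compat; lra |].
    replace (r / (2 * N) * N) with (r / 2) by (field; lra). lra. }
  specialize (H (eps * u) ltac:(rewrite Rabs_pos_eq; lra)).
  rewrite (Rabs_pos_eq (eps * u)) in H by lra.
  replace (alpha + G (eps * u) / eps - Derive G 0 * u)
    with (alpha + (G (eps * u) / eps - Derive G 0 * u)) by ring.
  eapply Rle_trans; [apply Rabs_triang |]. apply Rplus_le_compat_l.
  apply Rmult_le_reg_r with eps; [lra |].
  rewrite <- (Rabs_pos_eq eps) at 3 by lra. rewrite <- Rabs_mult.
  replace ((G (eps * u) / eps - Derive G 0 * u) * eps)
    with (G (eps * u) - Derive G 0 * (eps * u)) by (field; exact NE).
  eapply Rle_trans; [exact H |].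
  replace (d / N * (eps * u)) with (d / N * u * eps) by ring.
  apply Rmult_le_compat_r; [lra |].
  apply Rle_trans with (d / N * N).
  + apply Rmult_le_compat_l; [apply Rdiv_le_0_compat; lra | lra].
  + apply Req_le. field. lra.
Qed.

Lemma rescaled_lipschitz (F G : R -> R) (eps alpha N : R) :
  smooth F -> smooth G -> 0 <= eps -> 0 <= N ->
  exists L, forall u v, 0 <= u <= N -> 0 <= v <= N ->
    Rabs (rescaled_F F eps u - rescaled_F F eps v) <= L * Rabs (u - v) /\
    Rabs (rescaled_G G eps alpha u - rescaled_G G eps alpha v) <= L * Rabs (u - v).
Proof.
intros sF sG Heps HN. unfold rescaled_F, rescaled_G. destruct Req_dec_T as [E | NE].
- set (A := Derive_n F 2 0 / 2). set (B := Derive G 0).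
  exists (Rabs A * (2 * N) + Rabs B). intros u v Hu Hv.
  pose proof (Rabs_pos A). pose proof (Rabs_pos B). pose proof (Rabs_pos (u - v)).
  assert (0 <= Rabs A * (2 * N)) by (apply Rmult_le_pos; lra). split.
  + replace (A * u ^ 2 - A * v ^ 2) with (A * (u + v) * (u - v)) by ring.
    rewrite !Rabs_mult. apply Rmult_le_compat_r; [assumption |].
    rewrite (Rabs_pos_eq (u + v)) by lra.
    assert (Rabs A * (u + v) <= Rabs A * (2 * N)) by (apply Rmult_le_compat_l; lra). lra.
  + replace (alpha + B * u - (alpha + B * v)) with (B * (u - v)) by ring.
    rewrite Rabs_mult. apply Rmult_le_compat_r; lra.
- destruct (smooth_lipschitz F (eps * N) sF) as [LF [HLF KF]]; [apply Rmult_le_pos; lra |].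
  destruct (smooth_lipschitz G (eps * N) sG) as [LG [HLG KG]]; [apply Rmult_le_pos; lra |].
  assert (0 <= LF / eps) by (apply Rdiv_le_0_compat; lra).
  exists (LF / eps + LG). intros u v Hu Hv.
  assert (Bu : 0 <= eps * u <= eps * N)
    by (split; [apply Rmult_le_pos | apply Rmult_le_compat_l]; lra).
  assert (Bv : 0 <= eps * v <= eps * N)
    by (split; [apply Rmult_le_pos | apply Rmult_le_compat_l]; lra).
  specialize (KF _ _ Bu Bv). specialize (KG _ _ Bu Bv).
  rewrite <- Rmult_minus_distr_l, Rabs_mult, (Rabs_pos_eq eps) in KF, KG by lra.
  pose proof (Rabs_pos (u - v)).
  assert (0 < eps ^ 2) by nra. split.
  + replace (F (eps * u) / eps ^ 2 - F (eps * v) / eps ^ 2)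
      with ((F (eps * u) - F (eps * v)) / eps ^ 2) by (field; exact NE).
    unfold Rdiv. rewrite Rabs_mult, (Rabs_pos_eq (/ eps ^ 2))
      by (left; apply Rinv_0_lt_compat; assumption).
    apply Rle_trans with (LF * (eps * Rabs (u - v)) * / eps ^ 2).
    * apply Rmult_le_compat_r; [left; apply Rinv_0_lt_compat; assumption | exact KF].
    * replace (LF * (eps * Rabs (u - v)) * / eps ^ 2) with (LF / eps * Rabs (u - v))
        by (field; exact NE).
      apply Rmult_le_compat_r; unfold Rdiv in *; lra.
  + replace (alpha + G (eps * u) / eps - (alpha + G (eps * v) / eps))
      with ((G (eps * u) - G (eps * v)) / eps) by (field; exact NE).
    unfold Rdiv. rewrite Rabs_mult, (Rabs_pos_eq (/ eps))
      by (left; apply Rinv_0_lt_compat; lra).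
    apply Rle_trans with (LG * (eps * Rabs (u - v)) * / eps).
    * apply Rmult_le_compat_r; [left; apply Rinv_0_lt_compat; lra | exact KG].
    * replace (LG * (eps * Rabs (u - v)) * / eps) with (LG * Rabs (u - v))
        by (field; exact NE).
      apply Rmult_le_compat_r; unfold Rdiv in *; lra.
Qed.

Lemma Pi_plus_close (F G : R -> R) (y1 y2 eta : R) :
  smooth F -> smooth G -> F 0 = 0 -> Derive F 0 = 0 -> G 0 = 0 ->
  0 < Derive_n F 2 0 -> Derive G 0 < 0 -> 0 < y1 -> y1 <= y2 -> 0 < eta ->
  exists rho, 0 < rho /\ forall eps alpha ybar,
    0 <= eps <= rho -> Rabs alpha <= rho -> y1 <= ybar <= y2 ->
    (exists p, is_Pi_plus F G eps alpha ybar p) /\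
    (forall p, is_Pi_plus F G eps alpha ybar p ->
       - (beta F G / 2) <= p /\
       Rabs (axis_level (beta F G / 2) p - axis_level (beta F G / 2) ybar) < eta).
Proof.
intros sF sG F0 dF0 G0 HF HG Hy1 Hy12 Heta.
set (a := Derive_n F 2 0 / 2). set (b := beta F G / 2).
assert (Ha : 0 < a) by (unfold a; lra).
assert (Hab : 2 * a * b = - Derive G 0) by (unfold a, b, beta; field; lra).
assert (Hb : 0 < b) by nra.
destruct (half_return_close a b y1 y2 eta Ha Hb Hy1 Hy12 Heta) as [d [N [Hd [HN H]]]].
destruct (rescaled_F_close F N d sF F0 dF0 HN Hd) as [e1 [He1 HcF]].
destruct (rescaled_G_close G N (d / 2) sG G0 HN ltac:(lra)) as [e2 [He2 HcG]].
exists (Rmin (Rmin e1 e2) (d / 2)). split; [repeat apply Rmin_glb_lt; lra |].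
intros eps alpha ybar Heps Halpha Hybar.
assert (Hm : Rmin (Rmin e1 e2) (d / 2) <= e1 /\ Rmin (Rmin e1 e2) (d / 2) <= e2 /\
             Rmin (Rmin e1 e2) (d / 2) <= d / 2).
{ repeat split.
  - eapply Rle_trans; [apply Rmin_l | apply Rmin_l].
  - eapply Rle_trans; [apply Rmin_l | apply Rmin_r].
  - apply Rmin_r. }
destruct (rescaled_lipschitz F G eps alpha N sF sG ltac:(lra) ltac:(lra)) as [L HL].
destruct (H (rescaled_F F eps) (rescaled_G G eps alpha) L (rescaled_field F G eps alpha)
  (rescaled_field_split F G eps alpha) (rescaled_F_0 F eps F0) HL) with (ybar := ybar)
  as [Hex Hall]; [| exact Hybar |].
- intros u Hu. split; [apply HcF; lra |].
  rewrite Hab. replace (rescaled_G G eps alpha u + - Derive G 0 * u)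
    with (rescaled_G G eps alpha u - Derive G 0 * u) by ring.
  eapply Rle_trans; [apply HcG; lra | lra].
- split; [exact Hex | exact Hall].
Qed.

(** * Reflection in the axis and reversal of time *)

Definition reflect_F (F : R -> R) (x : R) : R := F (- x).
Definition reflect_G (G : R -> R) (x : R) : R := - G (- x).

Lemma smooth_reflect_F (F : R -> R) : smooth F -> smooth (reflect_F F).
Proof.
intros sF n x. apply ex_derive_n_comp_opp. apply filter_forall. intros y k _. apply sF.
Qed.

Lemma smooth_reflect_G (G : R -> R) : smooth G -> smooth (reflect_G G).
Proof. intros sG n x. apply ex_derive_n_opp. apply smooth_reflect_F, sG. Qed.

Lemma Derive_n_reflect_F (F : R -> R) (n : nat) :
  smooth F -> Derive_n (reflect_F F) n 0 = (-1) ^ n * Derive_n F n 0.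
Proof.
intros sF. unfold reflect_F. rewrite Derive_n_comp_opp.
- rewrite Ropp_0. reflexivity.
- apply filter_forall. intros y k _. apply sF.
Qed.

Lemma Derive_reflect_G (G : R -> R) : smooth G -> Derive (reflect_G G) 0 = Derive G 0.
Proof.
intros sG. unfold reflect_G. rewrite Derive_opp.
change (- Derive_n (reflect_F G) 1 0 = Derive_n G 1 0).
rewrite Derive_n_reflect_F by exact sG. ring.
Qed.

Lemma rescaled_field_reflect (F G : R -> R) (eps alpha x y : R) :
  smooth F -> smooth G ->
  rescaled_field (reflect_F F) (reflect_G G) eps (- alpha) (x, y) =
  (fst (rescaled_field F G eps alpha (- x, y)), - snd (rescaled_field F G eps alpha (- x, y))).
Proof.
intros sF sG. unfold rescaled_field. destruct Req_dec_T as [E | NE]; simpl fst; simpl snd.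
- rewrite Derive_n_reflect_F, Derive_reflect_G by assumption. f_equal; simpl; field.
- unfold reflect_F, reflect_G. rewrite Ropp_mult_distr_r. f_equal. field. exact NE.
Qed.

(** The map [(x, y, t) -> (- x, y, - t)] carries backward orbits in [x <= 0] to forward orbits in
    [x >= 0]. *)
Lemma Pi_minus_reflect (F G : R -> R) (eps alpha ybar p : R) :
  smooth F -> smooth G ->
  is_Pi_minus F G eps alpha ybar p <->
  is_Pi_plus (reflect_F F) (reflect_G G) eps (- alpha) ybar p.
Proof.
intros sF sG.
assert (Dx : forall (x : R -> R) t l, is_derive x (- t) l -> is_derive (fun s => - x (- s)) t l).
{ intros x t l H. auto_derive; [eexists; exact H |].
  replace (Derive (fun x0 : R => x x0) (- t)) with l
    by (symmetry; apply is_derive_unique; exact H). ring. }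
assert (Dy : forall (y : R -> R) t l, is_derive y (- t) l -> is_derive (fun s => y (- s)) t (- l)).
{ intros y t l H. auto_derive; [eexists; exact H |].
  replace (Derive (fun x0 : R => y x0) (- t)) with l
    by (symmetry; apply is_derive_unique; exact H). ring. }
split; intros [Hy [T [x [y [HT [Hsol [x0 [y0 [Hsgn [xT [yT [Hp Hfirst]]]]]]]]]]]];
  (split; [exact Hy |]);
  exists T, (fun t => - x (- t)), (fun t => y (- t)); (split; [exact HT |]);
  rewrite ?Ropp_involutive, ?Ropp_0, ?x0, ?y0, ?xT, ?yT, ?Ropp_0.
- split.
  { intros t Ht. destruct (Hsol (- t) ltac:(lra)) as [H1 H2].
    rewrite rescaled_field_reflect, Ropp_involutive by assumption.
    split; [apply Dx, H1 | apply Dy, H2]. }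
  repeat split; try assumption.
  + intros t Ht. specialize (Hsgn (- t) ltac:(lra)). lra.
  + intros t Ht [Hx0 Hy0]. apply (Hfirst (- t) ltac:(lra)). split; lra.
- split.
  { intros t Ht. destruct (Hsol (- t) ltac:(lra)) as [H1 H2].
    rewrite rescaled_field_reflect in H1, H2 by assumption. simpl in H1, H2.
    split; [apply Dx, H1 |].
    rewrite <- (Ropp_involutive (snd _)). apply Dy, H2. }
  repeat split; try assumption.
  + intros t Ht. specialize (Hsgn (- t) ltac:(lra)). lra.
  + intros t Ht [Hx0 Hy0]. apply (Hfirst (- t) ltac:(lra)). split; lra.
Qed.

Lemma Pi_minus_close (F G : R -> R) (y1 y2 eta : R) :
  smooth F -> smooth G -> F 0 = 0 -> Derive F 0 = 0 -> G 0 = 0 ->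
  0 < Derive_n F 2 0 -> Derive G 0 < 0 -> 0 < y1 -> y1 <= y2 -> 0 < eta ->
  exists rho, 0 < rho /\ forall eps alpha ybar,
    0 <= eps <= rho -> Rabs alpha <= rho -> y1 <= ybar <= y2 ->
    (exists p, is_Pi_minus F G eps alpha ybar p) /\
    (forall p, is_Pi_minus F G eps alpha ybar p ->
       - (beta F G / 2) <= p /\
       Rabs (axis_level (beta F G / 2) p - axis_level (beta F G / 2) ybar) < eta).
Proof.
intros sF sG F0 dF0 G0 HF HG Hy1 Hy12 Heta.
assert (D2 : Derive_n (reflect_F F) 2 0 = Derive_n F 2 0).
{ rewrite Derive_n_reflect_F by exact sF. ring. }
assert (D1 : Derive (reflect_F F) 0 = 0).
{ change (Derive_n (reflect_F F) 1 0 = 0). rewrite Derive_n_reflect_F by exact sF.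
  change (Derive_n F 1 0) with (Derive F 0). rewrite dF0. ring. }
assert (DG := Derive_reflect_G G sG).
assert (Hbeta : beta (reflect_F F) (reflect_G G) = beta F G).
{ unfold beta. rewrite D2, DG. reflexivity. }
destruct (Pi_plus_close (reflect_F F) (reflect_G G) y1 y2 eta) as [rho [Hrho H]];
  try assumption.
- apply smooth_reflect_F, sF.
- apply smooth_reflect_G, sG.
- unfold reflect_F. rewrite Ropp_0. exact F0.
- unfold reflect_G. rewrite Ropp_0, G0. apply Ropp_0.
- rewrite D2. exact HF.
- rewrite DG. exact HG.
- rewrite Hbeta in H. exists rho. split; [exact Hrho |].
  intros eps alpha ybar Heps Halpha Hybar.
  destruct (H eps (- alpha) ybar Heps ltac:(rewrite Rabs_Ropp; exact Halpha) Hybar) as [[p Hp] Hall].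
  split.
  + exists p. apply Pi_minus_reflect; assumption.
  + intros p' Hp'. apply Hall. apply Pi_minus_reflect; assumption.
Qed.

(** * The difference map *)

Theorem proposition5p2
  (Fm Gm Fp Gp : R -> R)
  (smFm : smooth Fm) (smGm : smooth Gm) (smFp : smooth Fp) (smGp : smooth Gp)
  (Fm0 : Fm 0 = 0) (dFm0 : Derive Fm 0 = 0) (Gm0 : Gm 0 = 0)
  (Fp0 : Fp 0 = 0) (dFp0 : Derive Fp 0 = 0) (Gp0 : Gp 0 = 0)
  (ddFm0 : 0 < Derive_n Fm 2 0) (dGm0 : Derive Gm 0 < 0)
  (ddFp0 : 0 < Derive_n Fp 2 0) (dGp0 : Derive Gp 0 < 0)
  (beta_neq : beta Fm Gm <> beta Fp Gp)
  (y1 y2 : R) (y1_gt0 : 0 < y1) (y1_le_y2 : y1 <= y2) :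
  exists (eps0 : R) (Um Up : R -> Prop),
    0 < eps0 /\ locally 0 Um /\ locally 0 Up /\
    forall eps alpham alphap : R,
      0 <= eps <= eps0 -> Um alpham -> Up alphap ->
      forall ybar : R, y1 <= ybar <= y2 ->
        (exists d : R, is_Delta Fm Gm Fp Gp eps alpham alphap ybar d) /\
        (forall d : R, is_Delta Fm Gm Fp Gp eps alpham alphap ybar d -> d <> 0).
Proof.
set (bm := beta Fm Gm / 2). set (bp := beta Fp Gp / 2).
assert (beta_pos : forall F G, 0 < Derive_n F 2 0 -> Derive G 0 < 0 -> 0 < beta F G / 2).
{ intros F G HF HG. unfold beta.
  replace (- (2 * Derive G 0 / Derive_n F 2 0) / 2) with (- Derive G 0 / Derive_n F 2 0)
    by (field; lra).
  apply Rdiv_lt_0_compat; lra. }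
assert (Hbm : 0 < bm) by (apply beta_pos; assumption).
assert (Hbp : 0 < bp) by (apply beta_pos; assumption).
destruct (uniform_gap (axis_level bm) (axis_level bp) (- bm) 0 y1 y2) as [m [Hm Hgap]].
{ apply continuous_axis_level. }
{ apply continuous_axis_level. }
{ intros p y Hp Hy Em Ep.
  destruct (Rtotal_order bm bp) as [Hlt | [Heq | Hgt]].
  - apply (axis_level_separates bm bp y p); lra || assumption.
  - unfold bm, bp in Heq. lra.
  - apply (axis_level_separates bp bm y p); lra || assumption. }
destruct (Pi_minus_close Fm Gm y1 y2 (m / 2)) as [rm [Hrm Hminus]]; try assumption; [lra |].
destruct (Pi_plus_close Fp Gp y1 y2 (m / 2)) as [rp [Hrp Hplus]]; try assumption; [lra |].
assert (nbhd : forall r, 0 < r -> locally 0 (fun z => Rabs z <= r)).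
{ intros r Hr. exists (mkposreal r Hr). intros z Hz. change (Rabs (z - 0) < r) in Hz.
  rewrite Rminus_0_r in Hz. lra. }
exists (Rmin rm rp), (fun z => Rabs z <= rm), (fun z => Rabs z <= rp).
split; [apply Rmin_glb_lt; assumption |].
split; [apply nbhd, Hrm |]. split; [apply nbhd, Hrp |].
intros eps alpham alphap Heps Ham Hap ybar Hybar.
pose proof (Rmin_l rm rp). pose proof (Rmin_r rm rp).
destruct (Hminus eps alpham ybar ltac:(lra) Ham Hybar) as [[pm Hpm] Hallm].
destruct (Hplus eps alphap ybar ltac:(lra) Hap Hybar) as [[pp Hpp] Hallp].
split.
- exists (pp - pm), pp, pm. tauto.
- intros d [qp [qm [Hqp [Hqm Hd]]]] Hd0. replace qp with qm in Hqp by lra.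
  destruct (Hallm qm Hqm) as [Hlow Hcm]. destruct (Hallp qm Hqp) as [_ Hcp].
  assert (Hneg : qm < 0) by (destruct Hqp as [_ [T [x [y Hq]]]]; tauto).
  pose proof (Hgap qm ybar ltac:(fold bm in Hlow; lra) Hybar).
  fold bm in Hcm. fold bp in Hcp. lra.
Qed.
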